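(* Let $p$ be a prime, $K$ the algebraic closure of $\mathbb{F}_p$, $q$ a power of $p$, and $r\ge 3$ an integer. Let $\mathcal{N}_{q,r}$ be the norm-trace curve over $K$ with affine equation $X^{\frac{q^r-1}{q-1}}=Y^{q^{r-1}}+Y^{q^{r-2}}+\cdots+Y$. Then $\mathrm{Aut}_K(\mathcal{N}_{q,r})$ has order $q^{r-1}(q^r-1)$ and is a semidirect product $G\rtimes C$, where $$G=\left\{(x,y)\mapsto(x,y+a)\mid \mathrm{Tr}_{q^r\mid q}(a)=0\right\},\qquad C=\left\{(x,y)\mapsto\left(bx,\,b^{\frac{q^r-1}{q-1}}y\right)\mid b\in\mathbb{F}_{q^r}^*\right\}.$$
   Context: The function field of the curve is $K(x,y)$ with $x^{\frac{q^r-1}{q-1}}=y^{q^{r-1}}+\cdots+y$. $\mathrm{Aut}_K(\mathcal{N}_{q,r})$ is the group of $K$-automorphisms of the function field $K(x,y)$ (equivalently, of the nonsingular model of the curve). An expression $(x,y)\mapsto(x',y')$ denotes the automorphism determined by sending $x$ to $x'$ and $y$ to $y'$. $\mathrm{Tr}_{q^r\mid q}(a)=a^{q^{r-1}}+a^{q^{r-2}}+\cdots+a$ for $a\in\mathbb{F}_{q^r}$ is the trace from $\mathbb{F}_{q^r}$ to $\mathbb{F}_q$. *)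

(* Defs.v *)
From HB Require Import structures.
From mathcomp Require Import all_boot all_order all_algebra all_field.
From mathcomp Require Import boolp classical_sets functions cardinality.

Set Implicit Arguments.
Unset Strict Implicit.
Unset Printing Implicit Defensive.

Import GRing.Theory.

Local Open Scope ring_scope.

Definition is_algebraic_closure (k : fieldType) (K : closedFieldType)
    (j : {rmorphism k -> K}) : Prop :=
  forall z : K, algebraicOver j z.

(* The subfield F_n of K, as the set of roots of T^n - T; it has n elements
   when K is algebraically closed and n is a power of its characteristic. *)
Definition Fsub (K : fieldType) (n : nat) : set K := [set a | a ^+ n = a].

(* Applied both to elements of F_{q^r} and to the indeterminate 'Y. *)
Definition Tr (R : nzRingType) (q r : nat) (a : R) : R :=
  \sum_(i < r) a ^+ (q ^ i).

Definition norm_exp (q r : nat) : nat := ((q ^ r - 1) %/ (q - 1))%N.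

(* Bivariate polynomials follow polyXY: 'X is the outer variable, 'Y = 'X%:P. *)
Definition norm_trace_poly (K : fieldType) (q r : nat) : {poly {poly K}} :=
  'X ^+ norm_exp q r - Tr q r 'Y.

Section FunctionField.
Variables (K F : fieldType) (iota : {rmorphism K -> F}).

Definition eval2 (x y : F) (g : {poly {poly K}}) : F :=
  (map_poly (map_poly iota) g).[x, y].

(* F is the fraction field of the coordinate ring K[X,Y]/(f), where x and y are
   the classes of 'X and 'Y: the first clause says that K[x,y] is isomorphic to
   K[X,Y]/(f), the second that F is its field of fractions. *)
Definition is_function_field (f : {poly {poly K}}) (x y : F) : Prop :=
  (forall g, eval2 x y g = 0 <-> exists h, g = h * f) /\
  (forall z : F, exists g h, eval2 x y h != 0 /\ z = eval2 x y g / eval2 x y h).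

Definition is_Kaut (s : F -> F) : Prop :=
  [/\ zmod_morphism s, monoid_morphism s, bijective s
    & forall c : K, s (iota c) = iota c].

Record Kaut : Type := MkKaut {
  Kaut_fun :> F -> F;
  KautP : is_Kaut Kaut_fun
}.

HB.instance Definition _ := gen_eqMixin Kaut.
HB.instance Definition _ := gen_choiceMixin Kaut.

Lemma Kaut_inj (s t : Kaut) : s =1 t -> s = t.
Proof.
case: s t => [s sP] [t tP] /= /funext st; subst t.
by congr MkKaut; apply: Prop_irrelevance.
Qed.

Lemma is_Kaut_id : is_Kaut id.
Proof. by split=> //; exists id. Qed.

Lemma is_Kaut_comp (s t : F -> F) : is_Kaut s -> is_Kaut t -> is_Kaut (s \o t).
Proof.
move=> [sB [s1 sM] sb sK] [tB [t1 tM] tb tK]; split.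
- by move=> u v /=; rewrite tB sB.
- by split=> [|u v] /=; rewrite ?t1 ?s1 // tM sM.
- exact: bij_comp.
- by move=> c /=; rewrite tK sK.
Qed.

Lemma Kaut_inv_ex (s : Kaut) :
  exists t : F -> F, [/\ cancel s t, cancel t s & is_Kaut t].
Proof.
have [sB [s1 sM] [t st ts] sK] := KautP s.
exists t; split=> //; split.
- by move=> u v; apply: (can_inj st); rewrite sB !ts.
- by split=> [|u v]; apply: (can_inj st); rewrite ?sM !ts.
- by exists s.
- by move=> c; rewrite -[in LHS]sK st.
Qed.

Definition Kaut_one : Kaut := MkKaut is_Kaut_id.

Definition Kaut_mul (s t : Kaut) : Kaut :=
  MkKaut (is_Kaut_comp (KautP s) (KautP t)).

Definition Kaut_inv (s : Kaut) : Kaut :=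
  MkKaut (let: And3 _ _ tP := projT2 (cid (Kaut_inv_ex s)) in tP).

Lemma Kaut_mulA : associative Kaut_mul.
Proof. by move=> s t u; apply: Kaut_inj. Qed.

Lemma Kaut_mul1 : left_id Kaut_one Kaut_mul.
Proof. by move=> s; apply: Kaut_inj. Qed.

Lemma Kaut_mulr1 : right_id Kaut_one Kaut_mul.
Proof. by move=> s; apply: Kaut_inj. Qed.

Lemma Kaut_mulV : left_inverse Kaut_one Kaut_inv Kaut_mul.
Proof.
by move=> s; apply: Kaut_inj => z; have [+ _ _] := projT2 (cid (Kaut_inv_ex s)); apply.
Qed.

Lemma Kaut_mulrV : right_inverse Kaut_one Kaut_inv Kaut_mul.
Proof.
by move=> s; apply: Kaut_inj => z; have [_ + _] := projT2 (cid (Kaut_inv_ex s)); apply.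
Qed.

(* (s * t)%g is s \o t. *)
HB.instance Definition _ := isGroup.Build Kaut
  Kaut_mulA Kaut_mul1 Kaut_mulr1 Kaut_mulV Kaut_mulrV.

(* (x, y) |-> (x, y + a) with Tr a = 0, a in F_{q^r} *)
Definition groupG (q r : nat) (x y : F) : set Kaut :=
  [set s : Kaut | exists a : K,
    [/\ Fsub (q ^ r) a, Tr q r a = 0, s x = x & s y = y + iota a]].

(* (x, y) |-> (b x, b^((q^r-1)/(q-1)) y) with b in F_{q^r}^* *)
Definition groupC (q r : nat) (x y : F) : set Kaut :=
  [set s : Kaut | exists b : K,
    [/\ Fsub (q ^ r) b, b != 0, s x = iota b * x
      & s y = iota (b ^+ norm_exp q r) * y]].

End FunctionField.

Arguments groupG {K F} iota q r x y.
Arguments groupC {K F} iota q r x y.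

(* gproduct's ><| only applies to finGroupType: A is the internal semidirect
   product of its normal subgroup N by its subgroup H. *)
Definition is_semidirect_product (A : groupType) (N H : set A) : Prop :=
  [/\ group_closed [in N], group_closed [in H],
      forall n s : A, N n -> N (n ^ s)%g,
      (N `&` H)%classic = [set 1%g]%classic
    & [set (n * h)%g | n in N & h in H]%classic = [set: A]%classic].

(* Main.v *)
(* Put d = q^(r-1) and m = (q^r - 1)/(q - 1). There is a single place at
   infinity, where x and y have the coprime pole orders d and m. At an affine
   point (a, b) the function x - a is a uniformizer, because the derivative of
   Tr is 1. As dx has no affine zero, x - a shows that d is a gap at every
   affine point when r >= 3, whereas it is not one at infinity: so the place at
   infinity is fixed by all automorphisms. An automorphism therefore preserves
   K[x, y] and its pole-order filtration, sends x to a x + b and y to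
   c y + k x + e, and comparing coefficients in the equation of the curve leaves
   b = k = 0, c = a^m = c^q and Tr e = 0.

   To avoid differentials, the gap argument is run on a function whose only pole
   is at (a, b), of order k <= d: multiplied by (x - a)^k it becomes a polynomial
   in x, y of degree at most d - 2 in y, vanishing at the d - 1 other points of
   the fibre over a, hence also at (a, b). *)

Require Import Defs.
From HB Require Import structures.
From mathcomp Require Import all_boot all_order all_algebra all_field.
From mathcomp Require Import boolp classical_sets functions cardinality.
From mathcomp Require Import zify ring.

Set Implicit Arguments.
Unset Strict Implicit.
Unset Printing Implicit Defensive.

Import GRing.Theory.

Local Open Scope ring_scope.

Section NormExponent.
Variables (q n : nat).
Hypotheses (q_gt1 : (1 < q)%N) (n_gt1 : (1 < n)%N).

Lemma norm_expE r : norm_exp q r = (\sum_(i < r) q ^ i)%N.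
Proof. by rewrite /norm_exp !subn1 predn_exp mulKn // -subn1 subn_gt0. Qed.

Lemma norm_exp_recr r : norm_exp q r.+1 = (norm_exp q r + q ^ r)%N.
Proof. by rewrite !norm_expE big_ord_recr. Qed.

Lemma norm_expM r : (norm_exp q r * (q - 1) = q ^ r - 1)%N.
Proof. by rewrite norm_expE !subn1 predn_exp mulnC. Qed.

Lemma norm_exp_recl r : norm_exp q r.+1 = (norm_exp q r * q).+1.
Proof.
rewrite !norm_expE big_ord_recl expn0 add1n big_distrl; congr _.+1.
by apply: eq_bigr => i _; rewrite lift0 expnSr.
Qed.

Lemma expn_gt3 : (3 < q ^ n)%N.
Proof.
have q1 := ltnW q_gt1; rewrite (@leq_trans (q ^ 2)) ?leq_pexp2l //.
by rewrite (@leq_trans (2 ^ 2)) ?leq_exp2r.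
Qed.

Lemma norm_exp_gt_q : (q < norm_exp q n)%N.
Proof.
have [k ->] : exists k, n = k.+2 by exists n.-2; lia.
by rewrite norm_exp_recl norm_exp_recl; lia.
Qed.

Lemma norm_exp_lt : (norm_exp q n < q ^ n)%N.
Proof. by have := norm_expM n; have := expn_gt3; nia. Qed.

Lemma norm_exp_bounds : (q ^ n + 2 < norm_exp q n.+1 < 2 * q ^ n)%N.
Proof.
by rewrite norm_exp_recr; have := norm_exp_gt_q; have := norm_exp_lt; lia.
Qed.

Lemma coprime_norm_exp : coprime (q ^ n) (norm_exp q n.+1).
Proof.
by rewrite coprimeXl // norm_exp_recl /coprime -addn1 gcdnMDl gcdn1.
Qed.

End NormExponent.

Section Frobenius.
Variables (R : comNzRingType) (p q : nat).
Hypotheses (pR : p \in [pchar R]) (pq : p.-nat q).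

Lemma exprD_q i (a b : R) : (a + b) ^+ (q ^ i) = a ^+ (q ^ i) + b ^+ (q ^ i).
Proof.
apply: exprDn_pchar; rewrite pnatX; apply/orP; left.
by apply: sub_in_pnat pq => k _; rewrite inE => /eqP ->.
Qed.

Lemma natr_pchar_eq0 : (1 < q)%N -> q%:R = 0 :> R.
Proof.
have [k ->] := p_natP pq; case: k => // k _.
by rewrite natrX (pcharf0 pR) expr0n.
Qed.

Lemma TrD r (a b : R) : Tr q r (a + b) = Tr q r a + Tr q r b.
Proof. by rewrite /Tr -big_split /=; apply: eq_bigr => i _; rewrite exprD_q. Qed.

Lemma TrB r (a b : R) : Tr q r (a - b) = Tr q r a - Tr q r b.
Proof. by apply/eqP; rewrite eq_sym subr_eq -TrD subrK. Qed.

End Frobenius.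

Lemma Tr_rmorph (A B : nzRingType) (f : {rmorphism A -> B}) q r a :
  f (Tr q r a) = Tr q r (f a).
Proof. by rewrite /Tr rmorph_sum; apply: eq_bigr => i _; rewrite rmorphXn. Qed.

Lemma Tr_recr (R : nzRingType) q n (a : R) :
  Tr q n.+1 a = Tr q n a + a ^+ (q ^ n).
Proof. by rewrite /Tr big_ord_recr. Qed.

Lemma trace_poly_size_monic (R : nzRingType) q n (c : R) :
  (1 < q)%N -> (0 < n)%N ->
  size (Tr q n.+1 'X - c%:P) = (q ^ n).+1 /\ Tr q n.+1 'X - c%:P \is monic.
Proof.
move=> q1 n0; set g : {poly R} := Tr q n 'X - c%:P.
have -> : Tr q n.+1 'X - c%:P = 'X^(q ^ n) + g by rewrite Tr_recr addrAC addrC.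
have sg : (size g < (q ^ n).+1)%N.
  rewrite ltnS /g (leq_trans (size_polyD _ _)) // geq_max size_polyN.
  rewrite (leq_trans (size_polyC_leq1 _)) ?andbT; last by rewrite expn_gt0 ltnW.
  apply: (leq_trans (size_sum _ _ _)); apply/bigmax_leqP => i _.
  by rewrite size_polyXn ltn_exp2l.
by rewrite monicE lead_coefDl ?size_polyXn // lead_coefXn eqxx size_polyDl ?size_polyXn.
Qed.

Lemma closed_field_uniq_roots (K : closedFieldType) (P : {poly K}) :
  P \is monic -> separable_poly P ->
  exists rs, [/\ uniq rs, size rs = (size P).-1 & forall b, (b \in rs) = root P b].
Proof.
move=> mP sP; have [rs PE] := closed_field_poly_normal P.
rewrite (monicP mP) scale1r in PE; exists rs; split.
- by rewrite -separable_prod_XsubC -PE.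
- by rewrite PE size_prod_XsubC.
- by move=> b; rewrite PE root_prod_XsubC.
Qed.

(* Each fibre of the trace has q^n distinct points, the trace polynomial having
   derivative 1. *)
Lemma trace_roots (K : closedFieldType) p q n (c : K) :
  p \in [pchar K] -> p.-nat q -> (1 < q)%N -> (0 < n)%N ->
  exists rs, [/\ uniq rs, size rs = (q ^ n)%N
             & forall b, (b \in rs) = (Tr q n.+1 b == c)].
Proof.
move=> pK pq q1 n0; have [sP mP] := trace_poly_size_monic c q1 n0.
have q0 : q%:R = 0 :> K := natr_pchar_eq0 pK pq q1.
have dP : (Tr q n.+1 'X - c%:P)^`() = 1.
  rewrite /Tr big_ord_recl -addrA derivD derivX derivB derivC subr0 raddf_sum big1.
    by rewrite addr0.
  by move=> i _; rewrite lift0 /= derivXn expnS -mulr_natr natrM -polyC_natr q0 !(mul0r, mulr0).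
have sepP : separable_poly (Tr q n.+1 'X - c%:P).
  by rewrite separable_poly.unlock dP coprimep1.
have [rs [u srs mem]] := closed_field_uniq_roots mP sepP.
exists rs; split; rewrite ?srs ?sP // => b; rewrite mem rootE hornerD hornerN hornerC.
suff -> : (Tr q n.+1 'X).[b] = Tr q n.+1 b by rewrite subr_eq0.
by rewrite /Tr horner_sum; apply: eq_bigr => i _; rewrite hornerXn.
Qed.

Lemma fixed_pow_roots (K : closedFieldType) (N : nat) : N%:R = 0 :> K -> (1 < N)%N ->
  exists rs : seq K, [/\ uniq rs, size rs = (N - 1)%N
    & forall a, (a \in rs) = (a != 0) && (a ^+ N == a)].
Proof.
move=> N0 N1; pose P : {poly K} := 'X^N - 'X.
have sP : (size (- 'X : {poly K}) < size ('X^N : {poly K}))%N.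
  by rewrite size_polyN size_polyX size_polyXn.
have mP : P \is monic by rewrite monicE lead_coefDl // lead_coefXn.
have dP : separable_poly P.
  rewrite separable_poly.unlock derivB derivX derivXn -mulr_natr -polyC_natr N0.
  by rewrite mulr0 sub0r -scaleN1r coprimepZr ?coprimep1 // oppr_eq0 oner_neq0.
have [rs [u srs mem]] := closed_field_uniq_roots mP dP.
have memE a : (a \in rs) = (a ^+ N == a).
  by rewrite mem rootE !hornerE subr_eq0.
exists (rem 0 rs); split; first exact: rem_uniq.
- rewrite size_rem; last by rewrite memE expr0n eqn0Ngt ltnW.
  by rewrite srs size_polyDl // size_polyXn subn1.
- by move=> a; rewrite mem_rem_uniq // inE memE.
Qed.

Lemma card_eq_seq (T : Type) (U : eqType) (rs : seq U) (f : T -> U) :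
  uniq rs -> (forall t, f t \in rs) -> injective f ->
  (forall u, u \in rs -> exists t, f t = u) ->
  ([set: T] #= `I_(size rs))%card.
Proof.
move=> urs frs f_inj f_surj; apply/card_set_bijP.
exists (fun t => index (f t) rs); split=> [t _|t t' _ _ ftt'|k /= k_lt].
- by rewrite /= index_mem.
- by apply: f_inj; rewrite -(nth_index (f t) (frs t)) ftt' nth_index.
have [u0 _] : exists u0, u0 \in rs.
  by case: (rs) k_lt => [//|u0 rs' _]; exists u0; apply: mem_head.
have [t tk] := f_surj _ (mem_nth u0 k_lt).
by exists t => //; rewrite tk index_uniq.
Qed.

(** * Evaluation at two elements of the function field *)

Section Eval2.
Variables (K F : fieldType) (iota : {rmorphism K -> F}) (u v : F).

Fact eval2_is_zmod_morphism : zmod_morphism (eval2 iota u v).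
Proof. by move=> g h; rewrite /eval2 rmorphB !hornerE. Qed.

Fact eval2_is_monoid_morphism : monoid_morphism (eval2 iota u v).
Proof. by split=> [|g h]; rewrite /eval2 ?rmorph1 ?rmorphM !hornerE. Qed.

HB.instance Definition _ :=
  GRing.isZmodMorphism.Build _ _ (eval2 iota u v) eval2_is_zmod_morphism.
HB.instance Definition _ :=
  GRing.isMonoidMorphism.Build _ _ (eval2 iota u v) eval2_is_monoid_morphism.

Lemma eval2_0 : eval2 iota u v 0 = 0. Proof. exact: rmorph0. Qed.
Lemma eval2_1 : eval2 iota u v 1 = 1. Proof. exact: rmorph1. Qed.
Lemma eval2D g h : eval2 iota u v (g + h) = eval2 iota u v g + eval2 iota u v h.
Proof. exact: rmorphD. Qed.
Lemma eval2B g h : eval2 iota u v (g - h) = eval2 iota u v g - eval2 iota u v h.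
Proof. exact: rmorphB. Qed.
Lemma eval2M g h : eval2 iota u v (g * h) = eval2 iota u v g * eval2 iota u v h.
Proof. exact: rmorphM. Qed.
Lemma eval2Xn g k : eval2 iota u v (g ^+ k) = eval2 iota u v g ^+ k.
Proof. exact: rmorphXn. Qed.
Lemma eval2_Tr q r g : eval2 iota u v (Tr q r g) = Tr q r (eval2 iota u v g).
Proof. exact: (Tr_rmorph (eval2 iota u v)). Qed.

Lemma eval2C c : eval2 iota u v c%:P = (map_poly iota c).[v].
Proof. by rewrite /eval2 map_polyC !hornerE. Qed.

Lemma eval2CC c : eval2 iota u v c%:P%:P = iota c.
Proof. by rewrite eval2C map_polyC hornerE. Qed.

Lemma eval2X : eval2 iota u v 'X = u.
Proof. by rewrite /eval2 map_polyX !hornerE. Qed.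

Lemma eval2Y : eval2 iota u v 'X%:P = v.
Proof. by rewrite eval2C map_polyX hornerE. Qed.

Lemma eval2_swap g : eval2 iota v u (swapXY g) = eval2 iota u v g.
Proof. by rewrite /eval2 -swapXY_map horner2_swapXY. Qed.

Lemma eval2_ind (P : F -> Prop) :
  (forall a b, P a -> P b -> P (a + b)) -> (forall a b, P a -> P b -> P (a * b)) ->
  (forall c, P (iota c)) -> P u -> P v -> forall g, P (eval2 iota u v g).
Proof.
move=> PD PM PC Pu Pv; elim/poly_ind => [|g c IH].
  by rewrite eval2_0 -(rmorph0 iota).
rewrite eval2D eval2M eval2X; apply: (PD) (PM _ _ IH Pu) _.
elim/poly_ind: c => [|c a IHc]; first by rewrite polyC0 eval2_0 -(rmorph0 iota).
by rewrite polyCD polyCM eval2D eval2M eval2Y eval2CC; apply: PD => //; apply: PM.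
Qed.

End Eval2.

Lemma eval2_idfun (K : fieldType) (a b : K) (g : {poly {poly K}}) :
  eval2 idfun b a g = g.[b%:P].[a].
Proof. by rewrite /eval2 map_poly_id // => k _; rewrite map_poly_id. Qed.

(** * Valuation rings of F containing K *)

Section ValuationRing.
Variables (K F : fieldType) (iota : {rmorphism K -> F}).

Definition valring (O : F -> Prop) : Prop :=
  [/\ forall c, O (iota c), forall a b, O a -> O b -> O (a + b),
      forall a b, O a -> O b -> O (a * b) & forall a, ~ O a -> O a^-1].

(* The maximal ideal, when O is a valuation ring. *)
Definition nonunit (O : F -> Prop) (a : F) : Prop := a = 0 \/ ~ O a^-1.

Definition residually_trivial (O : F -> Prop) : Prop :=
  forall a, O a -> exists c, nonunit O (a - iota c).

Variable O : F -> Prop.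
Hypothesis O_val : valring O.

Lemma valringC c : O (iota c). Proof. by case: O_val. Qed.
Lemma valringD a b : O a -> O b -> O (a + b). Proof. by case: O_val => _ + _ _; apply. Qed.
Lemma valringM a b : O a -> O b -> O (a * b). Proof. by case: O_val => _ _ + _; apply. Qed.
Lemma valringV a : ~ O a -> O a^-1. Proof. by case: O_val => _ _ _; apply. Qed.
Lemma valring0 : O 0. Proof. by rewrite -(rmorph0 iota); apply: valringC. Qed.
Lemma valring1 : O 1. Proof. by rewrite -(rmorph1 iota); apply: valringC. Qed.

Lemma valringX a k : O a -> O (a ^+ k).
Proof.
move=> Oa; elim: k => [|k IH]; first by rewrite expr0; apply: valring1.
by rewrite exprS; apply: valringM.
Qed.

Lemma valring_eval2 u v g : O u -> O v -> O (eval2 iota u v g).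
Proof.
move=> Ou Ov; apply: (eval2_ind (P := O)) => //.
- exact: valringD.
- exact: valringM.
- exact: valringC.
Qed.

Lemma nonunit0 : nonunit O 0. Proof. by left. Qed.

Lemma nonunit1 : ~ nonunit O 1.
Proof. by case=> [/eqP|]; rewrite ?oner_eq0 // invr1; apply; apply: valring1. Qed.

Lemma nonunit_valring a : nonunit O a -> O a.
Proof. by case=> [->|/valringV]; rewrite ?invrK //; apply: valring0. Qed.

Lemma valring_nonunitV a : ~ O a -> nonunit O a^-1.
Proof. by right; rewrite invrK. Qed.

Lemma nonunitM a b : nonunit O a -> O b -> nonunit O (a * b).
Proof.
case=> [->|Na] Ob; first by left; rewrite mul0r.
have [->|b0] := eqVneq b 0; first by left; rewrite mulr0.
right=> h; apply: Na; have := valringM h Ob.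
by rewrite invfM mulfVK.
Qed.

Lemma nonunitMl a b : O a -> nonunit O b -> nonunit O (a * b).
Proof. by move=> Oa Nb; rewrite mulrC; apply: nonunitM. Qed.

Lemma nonunitN a : nonunit O a -> nonunit O (- a).
Proof.
by rewrite -mulrN1 -(rmorphN1 iota) => Na; apply: nonunitM => //; apply: valringC.
Qed.

Lemma nonunitD a b : nonunit O a -> nonunit O b -> nonunit O (a + b).
Proof.
wlog Oab : a b / O (a / b) => [W Na Nb|Na Nb].
  have [/W|/valringV] := pselect (O (a / b)); first by apply.
  by rewrite invf_div => /W h; rewrite addrC; apply: h.
have [->|b0] := eqVneq b 0; first by rewrite addr0.
rewrite -[a](mulfVK b0) -[X in _ + X]mul1r -mulrDl mulrC; apply: nonunitM => //.
by apply: valringD => //; apply: valring1.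
Qed.

Lemma nonunitB a b : nonunit O a -> nonunit O b -> nonunit O (a - b).
Proof. by move=> Na Nb; apply: nonunitD => //; apply: nonunitN. Qed.

Lemma nonunitX a k : nonunit O a -> (0 < k)%N -> nonunit O (a ^+ k).
Proof.
move=> Na; case: k => // k _; rewrite exprS; apply: nonunitM => //.
by apply: valringX; apply: nonunit_valring.
Qed.

Lemma nonunitXE a k : nonunit O (a ^+ k) -> nonunit O a.
Proof.
case=> [/eqP|]; first by rewrite expf_eq0 => /andP[_ /eqP]; left.
by move=> h; right=> Oa; apply: h; rewrite -exprVn; apply: valringX.
Qed.

Lemma valringXE a k : O (a ^+ k) -> (0 < k)%N -> O a.
Proof.
move=> Ok k0; apply: contrapT => Oa.
have a0 : a != 0 by apply/eqP => a0; apply: Oa; rewrite a0; apply: valring0.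
have := nonunitM (nonunitX (valring_nonunitV Oa) k0) Ok.
by rewrite exprVn mulVf ?expf_neq0 //; apply: nonunit1.
Qed.

Lemma nonunitC c : nonunit O (iota c) -> c = 0.
Proof.
case=> [/eqP|]; first by rewrite fmorph_eq0 => /eqP.
by rewrite -fmorphV => /(_ (valringC _)).
Qed.

Lemma nonunit_unit a : nonunit O a -> O a^-1 -> a = 0.
Proof. by case=> // h /h. Qed.

Lemma unit_addC c a : c != 0 -> nonunit O a -> O (iota c + a)^-1.
Proof.
move=> c0 Na; apply: contrapT => h.
have: nonunit O (iota c + a) by right.
by move=> /nonunitB /(_ Na); rewrite addrK => /nonunitC /eqP; apply/negP.
Qed.

End ValuationRing.

(** * K-automorphisms *)

Section KautMorphism.
Variables (K F : fieldType) (iota : {rmorphism K -> F}).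

HB.instance Definition _ (s : Kaut iota) :=
  GRing.isZmodMorphism.Build F F (Kaut_fun s)
    (let: And4 sB _ _ _ := KautP s in sB).
HB.instance Definition _ (s : Kaut iota) :=
  GRing.isMonoidMorphism.Build F F (Kaut_fun s)
    (let: And4 _ sM _ _ := KautP s in sM).

Lemma KautC (s : Kaut iota) c : s (iota c) = iota c.
Proof. by case: (KautP s). Qed.

Lemma KautK (s : Kaut iota) : cancel s (s^-1)%g.
Proof. by move=> z; rewrite -[LHS]/((s^-1 * s)%g z) mulVg. Qed.

Lemma KautKV (s : Kaut iota) : cancel (s^-1)%g s.
Proof. by move=> z; rewrite -[LHS]/((s * s^-1)%g z) mulgV. Qed.

Lemma Kaut_eval2 (s : Kaut iota) u v g :
  s (eval2 iota u v g) = eval2 iota (s u) (s v) g.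
Proof.
elim/poly_ind: g => [|g c IH]; first by rewrite !eval2_0 rmorph0.
rewrite !eval2D !eval2M !eval2X rmorphD rmorphM /= IH; congr (_ + _).
elim/poly_ind: c => [|c a IHc]; first by rewrite polyC0 !eval2_0 rmorph0.
by rewrite polyCD polyCM !eval2D !eval2M !eval2Y !eval2CC rmorphD rmorphM /= IHc KautC.
Qed.

Lemma valring_Kaut (s : Kaut iota) O :
  valring iota O -> valring iota (fun z => O (s z)).
Proof.
move=> Ov; split=> [c|a b|a b|a].
- by rewrite KautC; apply: (valringC Ov).
- by move=> Oa Ob; rewrite rmorphD; apply: (valringD Ov).
- by move=> Oa Ob; rewrite rmorphM; apply: (valringM Ov).
- by rewrite fmorphV; apply: (valringV Ov).
Qed.

Lemma nonunit_Kaut (s : Kaut iota) O z :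
  nonunit (fun z => O (s z)) z <-> nonunit O (s z).
Proof.
rewrite /nonunit fmorphV; split=> -[h|h]; [left|right|left|right] => //.
  by rewrite h rmorph0.
by apply: (fmorph_inj s); rewrite rmorph0.
Qed.

Notation ev u v := (eval2 iota u v).

Lemma eval2_transport u v u' v' :
  (forall g, ev u v g = 0 <-> ev u' v' g = 0) ->
  (forall z, exists g h, ev u v h != 0 /\ z = ev u v g / ev u v h) ->
  exists s : F -> F, forall g h, ev u v h != 0 ->
    s (ev u v g / ev u v h) = ev u' v' g / ev u' v' h.
Proof.
move=> E fr.
have nz g : (ev u v g != 0) = (ev u' v' g != 0).
  by apply/idP/idP; apply: contraNneq => /E ->.
have /choice[N NP] z : exists gh : {poly {poly K}} * {poly {poly K}},
    ev u v gh.2 != 0 /\ z = ev u v gh.1 / ev u v gh.2.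
  by have [g [h gh]] := fr z; exists (g, h).
exists (fun z => ev u' v' (N z).1 / ev u' v' (N z).2) => g h h0.
have [] := NP (ev u v g / ev u v h); move: (N _) => [g1 h1] /= h10 /eqP.
rewrite eqr_div // -!eval2M -subr_eq0 -eval2B => /eqP/E/eqP.
rewrite eval2B subr_eq0 !eval2M => gE; apply/eqP.
by rewrite eqr_div -?nz // eq_sym.
Qed.

Lemma Kaut_of_eval2 u v u' v' :
  (forall g, ev u v g = 0 <-> ev u' v' g = 0) ->
  (forall z, exists g h, ev u v h != 0 /\ z = ev u v g / ev u v h) ->
  (forall z, exists g h, ev u' v' h != 0 /\ z = ev u' v' g / ev u' v' h) ->
  exists s : Kaut iota, s u = u' /\ s v = v'.
Proof.
move=> E fr fr'; have [s sE] := eval2_transport E fr.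
have E' g : ev u' v' g = 0 <-> ev u v g = 0 by symmetry; apply: E.
have [t tE] := eval2_transport E' fr'.
have nz g : (ev u v g != 0) = (ev u' v' g != 0).
  by apply/idP/idP; apply: contraNneq => /E ->.
have s_ev g : s (ev u v g) = ev u' v' g.
  by have := sE g 1; rewrite !eval2_1 !divr1; apply; apply: oner_neq0.
have sP : is_Kaut iota s.
  split.
  - move=> z w; have [g [h [h0 ->]]] := fr z; have [g' [h' [h'0 ->]]] := fr w.
    rewrite -mulNr addf_div // mulNr -!eval2M -eval2B !sE ?eval2M ?mulf_neq0 //.
    by rewrite eval2B !eval2M; field; rewrite -!nz h0 h'0.
  - split=> [|z w]; first by rewrite -[X in s X](eval2_1 iota u v) s_ev eval2_1.
    have [g [h [h0 ->]]] := fr z; have [g' [h' [h'0 ->]]] := fr w.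
    by rewrite mulf_div -!eval2M !sE ?eval2M ?mulf_neq0 // mulf_div.
  - exists t => z; [have [g [h [h0 ->]]] := fr z|have [g [h [h0 ->]]] := fr' z].
      by rewrite sE // tE // -nz.
    by rewrite tE // sE // nz.
  - by move=> c; rewrite -[X in s X](eval2CC iota u v) s_ev eval2CC.
exists (MkKaut sP) => /=.
by have := s_ev 'X; have := s_ev 'X%:P; rewrite !eval2X !eval2Y.
Qed.

Lemma eval2_affine_subst (c e b : K) g : exists g', forall u v,
  ev u v g' = ev (iota c * u + iota e) (iota b * v) g.
Proof.
have [X XE] : exists X, forall u v, ev u v X = iota c * u + iota e.
  by exists (c%:P%:P * 'X + e%:P%:P) => u v; rewrite eval2D eval2M !eval2CC eval2X.
have [Y YE] : exists Y, forall u v, ev u v Y = iota b * v.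
  by exists (b%:P%:P * 'X%:P) => u v; rewrite eval2M eval2CC eval2Y.
elim/poly_ind: g => [|g k [g1 IH]]; first by exists 0 => u v; rewrite !eval2_0.
have [k1 kE] : exists k1, forall u v,
    ev u v k1 = ev (iota c * u + iota e) (iota b * v) k%:P.
  elim/poly_ind: k => [|k z [k1 IHk]].
    by exists 0 => u v; rewrite polyC0 !eval2_0.
  exists (k1 * Y + z%:P%:P) => u v.
  by rewrite polyCD polyCM !eval2D !eval2M IHk YE !eval2CC eval2Y.
by exists (g1 * X + k1) => u v; rewrite !eval2D !eval2M IH XE kE eval2X.
Qed.

Lemma Tr_scale (c : K) (q r : nat) (z : F) :
  c ^+ q = c -> Tr q r (iota c * z) = iota c * Tr q r z.
Proof.
move=> cq; have cqi i : c ^+ (q ^ i) = c.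
  by elim: i => [|i IH]; rewrite ?expr1 // expnSr exprM IH.
by rewrite /Tr mulr_sumr; apply: eq_bigr => i _; rewrite exprMn -rmorphXn cqi.
Qed.

End KautMorphism.

Lemma coef_affine_exp (R : comNzRingType) (a b : R) k i : (i <= k)%N ->
  ((a%:P * 'X + b%:P) ^+ k)`_(k - i) = a ^+ (k - i) * b ^+ i *+ 'C(k, i).
Proof.
move=> ik; rewrite exprDn coef_sum (bigD1 (inord i)) //= inordK // big1 ?addr0.
  rewrite coefMn exprMn -!polyC_exp mulrAC -polyCM coefCM coefXn eqxx mulr1.
  by [].
move=> j ji; rewrite coefMn exprMn -!polyC_exp mulrAC -polyCM coefCM coefXn.
rewrite (_ : (k - i == k - j)%N = false) ?mulr0 ?mul0rn //.
have jk := ltn_ord j; apply/eqP => E; case/negP: ji; apply/eqP/val_inj => /=.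
by rewrite inordK //; lia.
Qed.

Section NormTrace.
Variables (K : closedFieldType) (F : fieldType) (iota : {rmorphism K -> F}).
Variables (p q n : nat) (x y : F).
Hypotheses (pK : p \in [pchar K]) (pq : p.-nat q).
Hypotheses (q_gt1 : (1 < q)%N) (n_gt1 : (1 < n)%N).
Notation d := (q ^ n)%N.
Notation m := (norm_exp q n.+1).

(* The outer variable 'X stands for y and 'Y for x, so that this is monic of
   degree d = q^(r-1) and K[x, y] is free over K[x]. *)
Definition trace_norm_poly : {poly {poly K}} := Tr q n.+1 'X - ('X ^+ m)%:P.
Notation f := trace_norm_poly.
Notation ev := (eval2 iota y x).

Hypothesis ev_ker : forall g, ev g = 0 <-> exists h : {poly {poly K}}, g = h * f.
Hypothesis ev_frac : forall z, exists g h, ev h != 0 /\ z = ev g / ev h.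

Let d_gt3 : (3 < d)%N := expn_gt3 q_gt1 n_gt1.
Let m_bounds : (d + 2 < m < 2 * d)%N := norm_exp_bounds q_gt1 n_gt1.

Lemma trace_normE : Tr q n.+1 y = x ^+ m.
Proof.
have /ev_ker : exists h : {poly {poly K}}, f = h * f by exists 1; rewrite mul1r.
rewrite /trace_norm_poly polyC_exp eval2B eval2Xn eval2_Tr eval2X eval2Y.
by move/eqP; rewrite subr_eq0 => /eqP.
Qed.

Lemma y_expd : y ^+ d = x ^+ m - \sum_(i < n) y ^+ (q ^ i).
Proof. by rewrite -trace_normE Tr_recr addrAC subrr add0r. Qed.

Lemma q_exp_lt (i : 'I_n) : (q ^ i < d)%N.
Proof. by rewrite ltn_exp2l. Qed.

Lemma size_trace_norm_poly : size f = d.+1 /\ f \is monic.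
Proof.
by apply: trace_poly_size_monic => //; apply: ltnW.
Qed.

Lemma ev_inj (g : {poly {poly K}}) : (size g <= d)%N -> ev g = 0 -> g = 0.
Proof.
have [sf mf] := size_trace_norm_poly.
move=> sg /ev_ker[h gE]; apply/eqP/negPn/negP => g0.
have h0 : h != 0 by apply: contraNneq g0 => h0; rewrite gE h0 mul0r.
by move: sg; rewrite gE size_Mmonic // sf; have := size_poly_gt0 h; rewrite h0; lia.
Qed.

Definition pmono i j : {poly {poly K}} := ('X^i)%:P * 'X^j.

Lemma coef_pmono c i j k l :
  ((c%:P%:P * pmono i j)`_k)`_l = c *+ ((k == j) && (l == i)).
Proof.
rewrite /pmono mulrA -rmorphM /= coefCM coefXn.
case: eqP => _; rewrite ?mulr0 ?coef0 // mulr1 coefCM coefXn.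
by case: eqP => _; rewrite ?mulr0 ?mulr1.
Qed.

Lemma ev_pmono c i j : ev (c%:P%:P * pmono i j) = iota c * x ^+ i * y ^+ j.
Proof. by rewrite /pmono polyC_exp !eval2M !eval2Xn eval2CC eval2X eval2Y mulrA. Qed.

(** * Pole orders at infinity *)

(* [wspan N z] holds when z is a combination of monomials of pole order < N at
   infinity; x and y have pole orders d and m there. *)
Inductive wspan (N : nat) : F -> Prop :=
| wspan0 : wspan N 0
| wspanS c i j z : (d * i + m * j < N)%N -> wspan N z ->
    wspan N (iota c * x ^+ i * y ^+ j + z).

Lemma wspan_mono N c i j :
  (d * i + m * j < N)%N -> wspan N (iota c * x ^+ i * y ^+ j).
Proof. by move=> h; rewrite -[_ * _]addr0; apply: wspanS => //; apply: wspan0. Qed.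

Lemma wspanD N z w : wspan N z -> wspan N w -> wspan N (z + w).
Proof.
elim=> [|c i j z' h _ IH] Vw; first by rewrite add0r.
by rewrite -addrA; apply: wspanS => //; apply: IH.
Qed.

Lemma wspan_le N M z : (N <= M)%N -> wspan N z -> wspan M z.
Proof.
move=> NM; elim=> [|c i j z' h _ IH]; first exact: wspan0.
by apply: wspanS => //; apply: leq_trans h NM.
Qed.

Lemma wspanM N M z w : wspan N z -> wspan M.+1 w -> wspan (N + M) (z * w).
Proof.
move=> Vz Vw; elim: Vz => [|c i j z' h _ IH]; first by rewrite mul0r; apply: wspan0.
rewrite mulrDl; apply: wspanD => //.
elim: Vw => [|c' i' j' w' h' _ IH']; first by rewrite mulr0; apply: wspan0.
rewrite mulrDr; apply: wspanD => //.
have -> : iota c * x ^+ i * y ^+ j * (iota c' * x ^+ i' * y ^+ j') =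
          iota (c * c') * x ^+ (i + i') * y ^+ (j + j').
  by rewrite rmorphM !exprD; ring.
by apply: wspan_mono; lia.
Qed.

Lemma wspanC N c : wspan N.+1 (iota c).
Proof.
have := @wspan_mono N.+1 c 0 0; rewrite !expr0 !mulr1; apply; lia.
Qed.

Lemma wspanZ N c z : wspan N z -> wspan N (iota c * z).
Proof. by move=> Vz; rewrite -[N]addn0 mulrC; apply: wspanM => //; apply: wspanC. Qed.

Lemma wspanN N z : wspan N z -> wspan N (- z).
Proof. by move/(wspanZ (-1)); rewrite rmorphN rmorph1 mulN1r. Qed.

Lemma wspanB N z w : wspan N z -> wspan N w -> wspan N (z - w).
Proof. by move=> Vz Vw; apply: wspanD => //; apply: wspanN. Qed.

Lemma wspanX N i z : wspan N.+1 z -> wspan (i * N).+1 (z ^+ i).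
Proof.
move=> Vz; elim: i => [|i IH].
  by rewrite expr0 -(rmorph1 iota); apply: wspanC.
by rewrite exprS mulSn -addSn; apply: wspanM.
Qed.

Lemma wspan_x : wspan d.+1 x.
Proof.
have := @wspan_mono d.+1 1 1 0; rewrite rmorph1 mul1r expr0 mulr1; apply; lia.
Qed.

Lemma wspan_y : wspan m.+1 y.
Proof.
have := @wspan_mono m.+1 1 0 1; rewrite rmorph1 mul1r expr0 mul1r; apply; lia.
Qed.

Lemma ev_wspan g : exists N, wspan N.+1 (ev g).
Proof.
apply: (eval2_ind (P := fun z => exists N, wspan N.+1 z)).
- move=> a b [N Va] [M Vb]; exists (maxn N M).
  by apply: wspanD; [apply: wspan_le Va | apply: wspan_le Vb]; lia.
- by move=> a b [N Va] [M Vb]; exists (N + M)%N; rewrite -addSn; apply: wspanM.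
- by move=> c; exists 0; apply: wspanC.
- by exists m; apply: wspan_y.
- by exists d; apply: wspan_x.
Qed.

(* Normal forms: representatives of degree < d in y. *)
Definition reduced (N : nat) (g : {poly {poly K}}) : Prop :=
  (size g <= d)%N /\ forall i j, (g`_j)`_i != 0 -> (d * i + m * j < N)%N.

Definition redspan (N : nat) (z : F) : Prop := exists2 g, reduced N g & z = ev g.

Lemma redspan0 N : redspan N 0.
Proof.
exists 0; last by rewrite eval2_0.
by split=> [|i j]; rewrite ?size_poly0 // !coef0 eqxx.
Qed.

Lemma redspanD N z w : redspan N z -> redspan N w -> redspan N (z + w).
Proof.
move=> [g [sg Vg] ->] [h [sh Vh] ->]; exists (g + h); last by rewrite eval2D.
split=> [|i j]; first by rewrite (leq_trans (size_polyD _ _)) // geq_max sg.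
rewrite !coefD; have [g0|/Vg //] := eqVneq ((g`_j)`_i) 0.
by rewrite g0 add0r => /Vh.
Qed.

Lemma redspan_le N M z : (N <= M)%N -> redspan N z -> redspan M z.
Proof.
move=> NM [g [sg Vg] ->]; exists g => //; split=> // i j /Vg h.
exact: leq_trans h NM.
Qed.

Lemma redspan_mono N c i j : (j < d)%N ->
  (d * i + m * j < N)%N -> redspan N (iota c * x ^+ i * y ^+ j).
Proof.
move=> jd h; exists (c%:P%:P * pmono i j); last by rewrite ev_pmono.
split=> [|k l]; last by rewrite coef_pmono; case: andP => [[/eqP -> /eqP ->]|]; rewrite ?eqxx.
rewrite /pmono mulrA -rmorphM /= mul_polyC (leq_trans (size_scale_leq _ _)) //.
by rewrite size_polyXn.
Qed.

Lemma redspanZ N c z : redspan N z -> redspan N (iota c * z).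
Proof.
move=> [g [sg Vg] ->]; exists (c%:P%:P * g); last by rewrite eval2M eval2CC.
split=> [|i j]; first by rewrite mul_polyC (leq_trans (size_scale_leq _ _)).
by rewrite !coefCM mulf_eq0 negb_or => /andP[_ /Vg].
Qed.

Lemma redspan_wspan N z : redspan N z -> wspan N z.
Proof.
move=> [g [_ Vg] ->].
have -> : ev g = \sum_(j < size g) \sum_(i < size g`_j)
                  iota (g`_j)`_i * x ^+ i * y ^+ j.
  rewrite -[in LHS](coefK g) poly_def (raddf_sum (eval2 iota y x)); apply: eq_bigr => j _ /=.
  rewrite -mul_polyC eval2M eval2Xn eval2X eval2C.
  rewrite -[in LHS](coefK g`_j) poly_def rmorph_sum horner_sum mulr_suml.
  apply: eq_bigr => i _; rewrite -mul_polyC rmorphM /= map_polyC map_polyXn.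
  by rewrite !hornerE.
apply: (big_ind (wspan N)); [exact: wspan0|exact: wspanD|move=> j _].
apply: (big_ind (wspan N)); [exact: wspan0|exact: wspanD|move=> i _].
have [->|/Vg] := eqVneq ((g`_j)`_i) 0; last exact: wspan_mono.
by rewrite rmorph0 !mul0r; apply: wspan0.
Qed.

Lemma mono_reduce i j : exists i0 j0, [/\ (j0 < d)%N,
  (d * i0 + m * j0 = d * i + m * j)%N &
  redspan (d * i + m * j) (x ^+ i * y ^+ j - x ^+ i0 * y ^+ j0)].
Proof.
elim/ltn_ind: j i => j IH i; have [jd|dj] := ltnP j d.
  by exists i, j; rewrite subrr; split=> //; apply: redspan0.
have [k jE] : exists k, j = (k + d)%N by exists (j - d)%N; lia.
have [|i0 [j0 [j0d wE V0]]] := IH k _ (i + m)%N; first by lia.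
exists i0, j0; split=> //; first by rewrite wE jE; lia.
have -> : x ^+ i * y ^+ j - x ^+ i0 * y ^+ j0 =
   x ^+ (i + m) * y ^+ k - x ^+ i0 * y ^+ j0
   + iota (-1) * \sum_(l < n) x ^+ i * y ^+ (k + q ^ l).
  rewrite jE exprD y_expd -mulr_sumr rmorphN rmorph1.
  under [in RHS]eq_bigr do rewrite exprD.
  by rewrite -mulr_sumr exprD; ring.
apply: redspanD; first by apply: redspan_le V0; rewrite jE; lia.
apply: redspanZ; apply: (big_ind (redspan _)); [exact: redspan0|exact: redspanD|].
move=> l _; have ql := q_exp_lt l.
have [|i1 [j1 [j1d wE1 V1]]] := IH (k + q ^ l)%N _ i; first by lia.
have wlt : (d * i + m * (k + q ^ l) < d * i + m * j)%N.
  by rewrite ltn_add2l ltn_mul2l jE ltn_add2l ql; lia.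
rewrite -[X in redspan _ X](subrK (x ^+ i1 * y ^+ j1)); apply: redspanD.
  by apply: redspan_le V1; apply: ltnW.
rewrite -[x ^+ i1]mul1r -(rmorph1 iota); apply: redspan_mono => //.
by rewrite wE1.
Qed.

Lemma wspan_redspan N z : wspan N z -> redspan N z.
Proof.
elim=> [|c i j z' h _ IH]; first exact: redspan0.
apply: redspanD => //; rewrite -mulrA; apply: redspanZ.
have [i0 [j0 [j0d wE V0]]] := mono_reduce i j.
rewrite -[_ * _](subrK (x ^+ i0 * y ^+ j0)); apply: redspanD.
  by apply: redspan_le V0; apply: ltnW.
by rewrite -[x ^+ i0]mul1r -(rmorph1 iota); apply: redspan_mono; rewrite ?wE.
Qed.

Lemma mono_notin i j : ~ wspan (d * i + m * j) (x ^+ i * y ^+ j).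
Proof.
move=> /wspan_redspan V.
have [i0 [j0 [j0d wE V0]]] := mono_reduce i j.
have [g [sg Vg] gE] : redspan (d * i + m * j) (x ^+ i0 * y ^+ j0).
  rewrite -(subKr (x ^+ i * y ^+ j) (x ^+ i0 * y ^+ j0)) -mulN1r -(rmorphN1 iota).
  by apply: redspanD => //; apply: redspanZ.
have mE : ev (1%:P%:P * pmono i0 j0 - g) = 0.
  by rewrite eval2B ev_pmono rmorph1 mul1r gE subrr.
have sE : (size (1%:P%:P * pmono i0 j0 - g)%R <= d)%N.
  rewrite (leq_trans (size_polyD _ _)) // geq_max size_polyN sg andbT.
  rewrite /pmono mulrA -rmorphM /= mul_polyC (leq_trans (size_scale_leq _ _)) //.
  by rewrite size_polyXn.
have := ev_inj sE mE.
move/eqP; rewrite subr_eq0 => /eqP/(congr1 (fun h : {poly {poly K}} => (h`_j0)`_i0)).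
rewrite coef_pmono !eqxx mulr1n => g1.
by have := Vg i0 j0; rewrite -g1 oner_eq0 wE ltnn => /(_ isT).
Qed.

Lemma mono_congr i j i' j' : (d * i + m * j = d * i' + m * j')%N ->
  wspan (d * i + m * j) (x ^+ i * y ^+ j - x ^+ i' * y ^+ j').
Proof.
move=> wE.
have [i0 [j0 [j0d w0 /redspan_wspan V0]]] := mono_reduce i j.
have [i1 [j1 [j1d w1 /redspan_wspan V1]]] := mono_reduce i' j'.
have j01 : j0 = j1.
  have co : coprime d m by apply: coprime_norm_exp.
  have /eqP : m * j0 = m * j1 %[mod d].
    by rewrite -(modnMDl i0) -[in RHS](modnMDl i1) mulnC w0 wE -w1 [(i1 * _)%N]mulnC.
  wlog le01 : j0 j1 {V0 V1 w0 w1} j0d j1d / (j1 <= j0)%N => [W|].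
    by case: (leqP j1 j0) => [|/ltnW] h; [|rewrite eq_sym => ?; apply/esym]; apply: W.
  rewrite eqn_mod_dvd ?leq_mul2l ?le01 ?orbT // -mulnBr Gauss_dvdr //.
  by move/dvdnP => [[|k] E]; lia.
have i01 : i0 = i1.
  apply/eqP; rewrite -(eqn_pmul2l (_ : 0 < d)%N); last by lia.
  by apply/eqP; apply: (@addIn (m * j0)); rewrite w0 wE -w1 j01.
rewrite -i01 -j01 -wE in V1; have := wspanB V0 V1.
by rewrite opprB addrA subrK.
Qed.

(* z has pole order exactly N at infinity. *)
Definition hasdeg N z := exists c i j,
  [/\ c != 0, (d * i + m * j = N)%N & wspan N (z - iota c * x ^+ i * y ^+ j)].

Lemma hasdeg_mono c i j :
  c != 0 -> hasdeg (d * i + m * j) (iota c * x ^+ i * y ^+ j).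
Proof. by move=> c0; exists c, i, j; rewrite subrr; split=> //; apply: wspan0. Qed.

Lemma hasdegC c : c != 0 -> hasdeg 0 (iota c).
Proof.
by move=> c0; have := hasdeg_mono 0 0 c0; rewrite !expr0 !mulr1 !muln0.
Qed.

Lemma hasdeg_x : hasdeg d x.
Proof.
have := hasdeg_mono 1 0 (oner_neq0 K).
by rewrite rmorph1 mul1r expr0 mulr1 muln0 muln1 addn0.
Qed.

Lemma hasdeg_wspan N z : hasdeg N z -> wspan N.+1 z.
Proof.
move=> [c [i [j [_ <- V]]]]; rewrite -(subrK (iota c * x ^+ i * y ^+ j) z).
by apply: wspanD; [apply: wspan_le V; lia | apply: wspan_mono; lia].
Qed.

Lemma hasdegM N M z w : hasdeg N z -> hasdeg M w -> hasdeg (N + M) (z * w).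
Proof.
move=> Hz Hw; have Vw := hasdeg_wspan Hw.
move: Hz Hw Vw => [c [i [j [c0 <- V]]]] [c' [i' [j' [c'0 <- V']]]] Vw.
exists (c * c'), (i + i')%N, (j + j')%N; split; [by rewrite mulf_neq0|by lia|].
have -> : z * w - iota (c * c') * x ^+ (i + i') * y ^+ (j + j') =
    (z - iota c * x ^+ i * y ^+ j) * w
    + (w - iota c' * x ^+ i' * y ^+ j') * (iota c * x ^+ i * y ^+ j).
  by rewrite rmorphM !exprD; ring.
apply: wspanD; first exact: wspanM.
by rewrite addnC; apply: wspanM => //; apply: wspan_mono; lia.
Qed.

Lemma hasdegX N z k : hasdeg N z -> hasdeg (k * N) (z ^+ k).
Proof.
move=> Hz; elim: k => [|k IH].
  by rewrite expr0 mul0n -(rmorph1 iota); apply: hasdegC; apply: oner_neq0.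
by rewrite exprS mulSn; apply: hasdegM.
Qed.

Lemma hasdeg_notin N z : hasdeg N z -> ~ wspan N z.
Proof.
move=> [c [i [j [c0 NE V]]]] Vz; apply: (@mono_notin i j); rewrite NE.
have := wspanZ c^-1 (wspanB Vz V).
by rewrite opprB addrC subrK mulrA mulrA -rmorphM mulVf // rmorph1 mul1r.
Qed.

Lemma hasdeg_lt N M z : hasdeg N z -> wspan M z -> (N < M)%N.
Proof.
by move=> Hz Vz; rewrite ltnNge; apply/negP => /wspan_le/(_ Vz); apply: hasdeg_notin.
Qed.

Lemma hasdeg_inj N M z : hasdeg N z -> hasdeg M z -> N = M.
Proof.
move=> HN HM; have := hasdeg_lt HN (hasdeg_wspan HM).
by have := hasdeg_lt HM (hasdeg_wspan HN); lia.
Qed.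

Lemma hasdeg_neq0 N z : hasdeg N z -> z != 0.
Proof. by move=> Hz; apply/eqP => z0; apply: (hasdeg_notin Hz); rewrite z0; apply: wspan0. Qed.

Lemma wspan_top N z : wspan N.+1 z -> wspan N z \/ hasdeg N z.
Proof.
elim=> [|c i j z' h _ IH]; first by left; apply: wspan0.
have [wN|wN] : (d * i + m * j < N \/ d * i + m * j = N)%N by lia.
  case: IH => [V|[c' [i' [j' [c'0 NE V]]]]]; [left|right]; first exact: wspanS.
  by exists c', i', j'; split=> //; rewrite -addrA; apply: wspanS.
have [->|c0] := eqVneq c 0; first by rewrite rmorph0 !mul0r add0r.
case: IH => [V|[c' [i' [j' [c'0 NE V]]]]].
  by right; exists c, i, j; split=> //; rewrite addrC addKr.
have E : iota c * x ^+ i * y ^+ j + z' - iota (c + c') * x ^+ i * y ^+ j =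
    (z' - iota c' * x ^+ i' * y ^+ j')
     + iota c' * (x ^+ i' * y ^+ j' - x ^+ i * y ^+ j).
  by rewrite rmorphD; ring.
have VE : wspan N (iota c * x ^+ i * y ^+ j + z' - iota (c + c') * x ^+ i * y ^+ j).
  rewrite E; apply: wspanD => //; apply: wspanZ; rewrite -NE.
  by apply: mono_congr; rewrite NE wN.
have [cc0|cc0] := eqVneq (c + c') 0; last by right; exists (c + c'), i, j.
by left; move: VE; rewrite cc0 rmorph0 !mul0r subr0.
Qed.

Lemma wspan_deg N z : wspan N z -> z = 0 \/ exists2 k, (k < N)%N & hasdeg k z.
Proof.
elim: N z => [|N IH] z.
  by move=> V; left; case: V => // c i j z' h; lia.
case/wspan_top=> [/IH[->|[k kN Hk]]|Hz]; [by left| |].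
  by right; exists k => //; apply: ltnW.
by right; exists N.
Qed.

Lemma ev_deg g : ev g != 0 -> exists N, hasdeg N (ev g).
Proof.
have [N /wspan_deg[->|[k _ Hk] _]] := ev_wspan g; first by rewrite eqxx.
by exists k.
Qed.

Lemma x_neq0 : x != 0. Proof. exact: hasdeg_neq0 hasdeg_x. Qed.

Lemma frac_deg z : z != 0 -> exists g h N M,
  [/\ hasdeg N g, hasdeg M h & z = g / h].
Proof.
have [g [h [h0 ->]]] := ev_frac z; rewrite mulf_eq0 negb_or => /andP[g0 _].
have [N HN] := ev_deg g0; have [M HM] := ev_deg h0.
by exists (ev g), (ev h), N, M.
Qed.

(** * The place at infinity *)

Definition Oinf z := exists N g h, [/\ wspan N.+1 g, hasdeg N h & z = g / h].
Definition minf z := exists N g h, [/\ wspan N g, hasdeg N h & z = g / h].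

Lemma minf0 : minf 0.
Proof.
by exists d, 0, x; rewrite mul0r; split=> //; [apply: wspan0|apply: hasdeg_x].
Qed.

Lemma minf_Oinf z : minf z -> Oinf z.
Proof.
by move=> [N [g [h [V H ->]]]]; exists N, g, h; split=> //; apply: wspan_le V.
Qed.

Lemma OinfV z : ~ Oinf z -> minf z^-1.
Proof.
have [->|/frac_deg[g [h [N [M [Hg Hh ->]]]]]] := eqVneq z 0.
  by case; apply: minf_Oinf; apply: minf0.
move=> nO; exists N, h, g; rewrite invf_div; split=> //.
apply: wspan_le (hasdeg_wspan Hh); rewrite ltnNge; apply/negP => NM.
by apply: nO; exists M, g, h; split=> //; apply: wspan_le (hasdeg_wspan Hg).
Qed.

Lemma valring_Oinf : valring iota Oinf.
Proof.
split=> [c|_ _ [N [g [h [V H ->]]]] [N' [g' [h' [V' H' ->]]]]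
        |_ _ [N [g [h [V H ->]]]] [N' [g' [h' [V' H' ->]]]]|z /OinfV/minf_Oinf //].
- exists 0, (iota c), (iota 1); split; first exact: wspanC.
    by apply: hasdegC; apply: oner_neq0.
  by rewrite rmorph1 divr1.
- exists (N + N')%N, (g * h' + g' * h), (h * h'); split; last 2 first.
  + exact: hasdegM.
  + by rewrite addf_div ?(hasdeg_neq0 H) ?(hasdeg_neq0 H').
  apply: wspanD; first by rewrite -addSn; apply: wspanM => //; apply: hasdeg_wspan.
  by rewrite addnC -addSn; apply: wspanM => //; apply: hasdeg_wspan.
- exists (N + N')%N, (g * g'), (h * h'); split; last 2 first.
  + exact: hasdegM.
  + by rewrite mulf_div.
  by rewrite -addSn; apply: wspanM.
Qed.

Lemma minfP z : minf z <-> nonunit Oinf z.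
Proof.
split=> [[N [g [h [V H ->]]]]|[->|/OinfV]]; [|exact: minf0|by rewrite invrK].
have [->|g0] := eqVneq g 0; first by left; rewrite mul0r.
right=> -[N' [g' [h' [V' H' E]]]].
apply: (hasdeg_notin (hasdegM H H')).
have -> : h * h' = g * g'.
  move/eqP: E; rewrite invf_div eqr_div ?(hasdeg_neq0 H') // => /eqP ->.
  by rewrite mulrC.
exact: wspanM.
Qed.

Lemma Oinf_x : ~ Oinf x.
Proof.
move=> [N [g [h [V H E]]]]; have g_E : x * h = g by rewrite E divfK // (hasdeg_neq0 H).
by have := hasdeg_lt (hasdegM hasdeg_x H); rewrite g_E => /(_ _ V); lia.
Qed.

Lemma residually_trivial_Oinf : residually_trivial iota Oinf.
Proof.
move=> _ [N [g [h [V H ->]]]].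
have [Vg|[c [i [j [c0 wN Vg]]]]] := wspan_top V.
  by exists 0; rewrite rmorph0 subr0; apply/minfP; exists N, g, h.
have h0 := hasdeg_neq0 H.
case: H (H) => [c' [i' [j' [c'0 wN' Vh]]]] H; exists (c / c'); apply/minfP.
exists N, (g - iota (c / c') * h), h; split=> //; last first.
  by rewrite mulrBl mulfK.
have -> : g - iota (c / c') * h = (g - iota c * x ^+ i * y ^+ j)
   - iota (c / c') * (h - iota c' * x ^+ i' * y ^+ j')
   + iota c * (x ^+ i * y ^+ j - x ^+ i' * y ^+ j').
  have -> : iota c = iota (c / c') * iota c' by rewrite -rmorphM mulfVK.
  by ring.
apply: wspanD; first by apply: wspanB => //; apply: wspanZ.
by apply: wspanZ; rewrite -wN; apply: mono_congr; rewrite wN wN'.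
Qed.

Lemma trace_tail_nonunit O : valring iota O -> ~ O y ->
  nonunit O (\sum_(i < n) y ^+ (q ^ i) / y ^+ d).
Proof.
move=> Ov Oy; have y0 : y != 0.
  by apply/eqP => y0; apply: Oy; rewrite y0; apply: (valring0 Ov).
apply: (big_ind (nonunit O)); first exact: nonunit0; first exact: (nonunitD Ov).
move=> i _; have qi := q_exp_lt i.
have -> : y ^+ (q ^ i) / y ^+ d = y^-1 ^+ (d - q ^ i).
  have -> : y ^+ d = y ^+ (q ^ i) * y ^+ (d - q ^ i) by rewrite -exprD subnKC // ltnW.
  by rewrite invfM mulrA mulfV ?expf_neq0 // mul1r exprVn.
by apply: (nonunitX Ov (valring_nonunitV Oy)); lia.
Qed.

Lemma trace_norm_div : y != 0 ->
  x ^+ m / y ^+ d = 1 + \sum_(i < n) y ^+ (q ^ i) / y ^+ d.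
Proof.
move=> y0; rewrite -trace_normE Tr_recr mulrDl mulfV ?expf_neq0 //.
by rewrite /Tr mulr_suml addrC.
Qed.

Lemma valring_x_y O : valring iota O -> O x -> O y.
Proof.
move=> Ov Ox; apply: contrapT => Oy; have Nt := trace_tail_nonunit Ov Oy.
have y0 : y != 0 by apply/eqP => y0; apply: Oy; rewrite y0; apply: (valring0 Ov).
apply: (nonunit1 Ov); have -> : 1 = x ^+ m * y^-1 ^+ d - \sum_(i < n) y ^+ (q ^ i) / y ^+ d.
  by rewrite exprVn trace_norm_div // addrK.
apply: (nonunitB Ov) => //; apply: (nonunitMl Ov); first exact: (valringX Ov).
by apply: (nonunitX Ov (valring_nonunitV Oy)); lia.
Qed.

(* A valuation ring O without x is that of infinity: in its value group x and y
   are in the ratio d : m, since x^m / y^d is a unit. *)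
Section NotContainingX.
Variable O : F -> Prop.
Hypotheses (Ov : valring iota O) (Ox : ~ O x).

Lemma valring_x_inv : nonunit O x^-1. Proof. exact: valring_nonunitV. Qed.

Lemma valring_y : ~ O y.
Proof.
move=> Oy; apply: Ox; apply: (valringXE Ov (k := m)); last by lia.
rewrite -trace_normE /Tr; apply: (big_ind O); first exact: (valring0 Ov).
  exact: (valringD Ov).
by move=> i _; apply: (valringX Ov).
Qed.

Lemma y_neq0 : y != 0.
Proof. by apply/eqP => y0; apply: valring_y; rewrite y0; apply: (valring0 Ov). Qed.

Let w := x ^+ m / y ^+ d.

Lemma valring_w : O w /\ O w^-1.
Proof.
have Ns := trace_tail_nonunit Ov valring_y.
have wE : w = iota 1 + \sum_(i < n) y ^+ (q ^ i) / y ^+ d.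
  by rewrite rmorph1 -trace_norm_div // y_neq0.
rewrite wE; split; last exact: (unit_addC Ov (oner_neq0 _)).
by apply: (valringD Ov); [exact: (valringC Ov)|exact: (nonunit_valring Ov)].
Qed.

Lemma valring_mono i j i' j' :
  (d * i + m * j <= d * i' + m * j')%N ->
  O (x ^+ i * y ^+ j / (x ^+ i' * y ^+ j')) /\
  ((d * i + m * j < d * i' + m * j')%N ->
   nonunit O (x ^+ i * y ^+ j / (x ^+ i' * y ^+ j'))).
Proof.
move=> le_w; set z := _ / _; have [Ow OwV] := valring_w.
have ME k l : (x ^+ k * y ^+ l) ^+ d = x ^+ (d * k + m * l) * w^-1 ^+ l.
  rewrite /w exprMn exprD !exprM -!exprM invf_div expr_div_n -!exprM.
  rewrite ![(_ * d)%N]mulnC -mulrA; congr (_ * _).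
  by rewrite mulrCA mulfV ?mulr1 // expf_neq0 // x_neq0.
set e := (d * i' + m * j' - (d * i + m * j))%N.
have zE : z ^+ d = x^-1 ^+ e * (w^-1 ^+ j * w ^+ j').
  rewrite /z expr_div_n !ME -(subnKC le_w) -/e (exprD x _ e) !exprVn.
  have X0 k : x ^+ k != 0 by rewrite expf_neq0 ?x_neq0.
  have w0 : w != 0 by rewrite mulf_neq0 ?invr_eq0 ?expf_neq0 ?x_neq0 ?y_neq0.
  have W0 k : w ^+ k != 0 by rewrite expf_neq0.
  move: (X0 (d * i + m * j)%N) (X0 e) (W0 j) (W0 j').
  move: (x ^+ (_ + _)) (x ^+ e) (w ^+ j) (w ^+ j') => A B C D A0 B0 C0 D0.
  by field; do ?[apply/and3P; split] => //; rewrite ?A0 ?B0 ?C0 ?D0.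
have Owj : O (w^-1 ^+ j * w ^+ j') by apply: (valringM Ov); apply: (valringX Ov).
split=> [|lt_w].
  apply: (valringXE Ov (k := d)); last by lia.
  rewrite zE; apply: (valringM Ov) => //; apply: (valringX Ov).
  exact: (nonunit_valring Ov valring_x_inv).
apply: (nonunitXE Ov (k := d)); rewrite zE; apply: (nonunitM Ov) => //.
by apply: (nonunitX Ov valring_x_inv); rewrite /e; lia.
Qed.

Lemma valring_wspan g i j :
  (wspan (d * i + m * j).+1 g -> O (g / (x ^+ i * y ^+ j))) /\
  (wspan (d * i + m * j) g -> nonunit O (g / (x ^+ i * y ^+ j))).
Proof.
split; elim=> [|c k l g' lt_w _ IH]; rewrite ?mul0r; [exact: (valring0 Ov)| |exact: nonunit0|].
  rewrite mulrDl; apply: (valringD Ov) => //; rewrite -!mulrA mulrA -mulrA.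
  apply: (valringM Ov); first exact: (valringC Ov).
  by rewrite mulrA; have [] := @valring_mono k l i j; first by lia.
rewrite mulrDl; apply: (nonunitD Ov) => //; rewrite -!mulrA.
apply: (nonunitMl Ov); first exact: (valringC Ov).
by rewrite mulrA; have [|_] := @valring_mono k l i j; [by lia|apply].
Qed.

Lemma valring_frac N g h : hasdeg N h ->
  (wspan N.+1 g -> O (g / h)) /\ (wspan N g -> nonunit O (g / h)).
Proof.
move=> H; have h0 := hasdeg_neq0 H; case: H => [c [i [j [c0 <- V]]]].
set M := x ^+ i * y ^+ j.
have M0 : M != 0 by rewrite mulf_neq0 ?expf_neq0 ?x_neq0 ?y_neq0.
have Oh : O (h / M)^-1.
  have -> : h / M = iota c + (h - iota c * x ^+ i * y ^+ j) / M.
    by rewrite mulrBl -mulrA mulfK // addrC subrK.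
  by apply: (unit_addC Ov) => //; have [_] := valring_wspan (h - iota c * x ^+ i * y ^+ j) i j; apply.
have -> : g / h = (g / M) * (h / M)^-1 by field; rewrite h0 M0.
have [VO VN] := valring_wspan g i j.
split=> Vg; first by apply: (valringM Ov) => //; apply: VO.
by apply: (nonunitM Ov) => //; apply: VN.
Qed.

Lemma valring_eq_Oinf z : O z <-> Oinf z.
Proof.
split=> [Oz|[N [g [h [V H ->]]]]]; last by have [+ _] := valring_frac g H; apply.
apply: contrapT => nO; have [N [g [h [V H E]]]] := OinfV nO.
have [_ /(_ V)] := valring_frac g H; rewrite -E => -[/eqP|]; last by rewrite invrK.
rewrite invr_eq0 => /eqP z0; apply: nO; rewrite z0; apply: minf_Oinf; exact: minf0.
Qed.

End NotContainingX.

(** * The affine places *)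

Section AffinePoint.
Variables (a b : K).
Hypothesis Pab : Tr q n.+1 b = a ^+ m.
Notation at_ := (eval2 idfun b a).

Lemma at_f : at_ f = 0.
Proof.
by rewrite /trace_norm_poly polyC_exp eval2B eval2Xn eval2_Tr eval2X eval2Y Pab subrr.
Qed.

Lemma at_ev g h : ev g = ev h -> at_ g = at_ h.
Proof.
move=> gh; have /ev_ker[k kE] : ev (g - h) = 0 by rewrite eval2B gh subrr.
by apply/eqP; rewrite -subr_eq0 -eval2B kE eval2M at_f mulr0.
Qed.

Lemma at_ev_neq0 h : at_ h != 0 -> ev h != 0.
Proof.
by apply: contraNneq => h0; rewrite (@at_ev _ 0) ?eval2_0.
Qed.

Definition OP z := exists g h, at_ h != 0 /\ z = ev g / ev h.
Definition unitP z := exists g h, [/\ at_ g != 0, at_ h != 0 & z = ev g / ev h].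

Lemma OP_ev g : OP (ev g).
Proof. by exists g, 1; rewrite !eval2_1 oner_neq0 divr1. Qed.

Lemma unitP_OP u : unitP u -> OP u /\ OP u^-1.
Proof.
by move=> [g [h [g0 h0 ->]]]; split; [exists g, h|exists h, g; rewrite invf_div].
Qed.

Lemma unitPM u v : unitP u -> unitP v -> unitP (u * v).
Proof.
move=> [g [h [g0 h0 ->]]] [g' [h' [g'0 h'0 ->]]].
by exists (g * g'), (h * h'); rewrite !eval2M !mulf_neq0 // mulf_div.
Qed.

Lemma unitPV u : unitP u -> unitP u^-1.
Proof. by move=> [g [h [g0 h0 ->]]]; exists h, g; rewrite invf_div. Qed.

Lemma unitP_neq0 u : unitP u -> u != 0.
Proof.
by move=> [g [h [g0 h0 ->]]]; rewrite mulf_neq0 ?invr_eq0 ?at_ev_neq0.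
Qed.

Lemma OPD z w : OP z -> OP w -> OP (z + w).
Proof.
move=> [g [h [h0 ->]]] [g' [h' [h'0 ->]]]; exists (g * h' + g' * h), (h * h').
by rewrite eval2D !eval2M mulf_neq0 // addf_div ?at_ev_neq0.
Qed.

Lemma OPM z w : OP z -> OP w -> OP (z * w).
Proof.
move=> [g [h [h0 ->]]] [g' [h' [h'0 ->]]]; exists (g * g'), (h * h').
by rewrite !eval2M mulf_neq0 // mulf_div.
Qed.

Notation t := (x - iota a).

Lemma at_factor g :
  exists g1 g2, g = (at_ g)%:P%:P + g1 * ('X - a%:P)%:P + g2 * ('X - b%:P%:P).
Proof.
have [g2 g2E] : exists g2, g - (g.[b%:P])%:P = g2 * ('X - b%:P%:P).
  by apply/factor_theorem; rewrite rootE hornerD hornerN hornerC subrr.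
have [c cE] : exists c, g.[b%:P] - (g.[b%:P].[a])%:P = c * ('X - a%:P).
  by apply/factor_theorem; rewrite rootE hornerD hornerN hornerC subrr.
exists c%:P, g2.
by rewrite eval2_idfun -g2E -polyCM -cE polyCB subrKC addrC subrK.
Qed.

Lemma ev_t : ev ('X - a%:P)%:P = t.
Proof. by rewrite polyCB eval2B eval2Y eval2CC. Qed.

Lemma t_neq0 : t != 0.
Proof.
apply/eqP => t0; apply: Oinf_x; move/eqP: t0; rewrite subr_eq0 => /eqP ->.
exact: (valringC valring_Oinf).
Qed.

(* Tr (y - b) = x^m - a^m, and Tr (y - b) = (y - b) * D with D = 1 at the point:
   hence x - a is a uniformizer. *)
Lemma vanish_factor g :
  at_ g = 0 -> exists D g1, at_ D != 0 /\ ev D * ev g = t * ev g1.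
Proof.
move=> g0; have [g1 [g2 gE]] := at_factor g.
have [S SE] : exists S, 'X^m - (a ^+ m)%:P = S * ('X - a%:P).
  by apply/factor_theorem; rewrite rootE !hornerE subrr.
pose B : {poly {poly K}} := 'X - b%:P%:P.
pose D := \sum_(i < n.+1) B ^+ (q ^ i).-1.
have DB : ev D * ev B = ev S%:P * t.
  rewrite -ev_t -!eval2M -polyCM -SE polyCB polyC_exp eval2B eval2Xn eval2Y eval2CC.
  have -> : D * B = Tr q n.+1 B.
    rewrite /D mulr_suml; apply: eq_bigr => i _; rewrite -exprSr prednK //.
    by rewrite expn_gt0 ltnW.
  rewrite eval2_Tr eval2B eval2X eval2CC.
  have pF : p \in [pchar F] by rewrite (fmorph_pchar iota).
  rewrite (TrB pF pq) trace_normE -Tr_rmorph Pab.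
  by [].
have D1 : at_ D = 1.
  rewrite /D (raddf_sum (eval2 idfun b a)) big_ord_recl.
  rewrite [X in X + _](_ : _ = 1); last exact: eval2_1.
  rewrite big1 ?addr0 // => i _; rewrite /= eval2Xn eval2B eval2X eval2CC subrr expr0n.
  suff -> : (q ^ lift ord0 i).-1 == 0%N = false by [].
  by rewrite lift0 expnS; have : (0 < q ^ i)%N by [rewrite expn_gt0 ltnW]; nia.
exists D, (D * g1 + S%:P * g2); rewrite D1 oner_neq0; split=> //.
rewrite {1}gE g0 !polyC0 add0r !eval2D !eval2M ev_t mulrDr -/B.
by rewrite [ev D * (ev g2 * _)]mulrCA DB; ring.
Qed.

Lemma point_order e g g' h : at_ h != 0 -> ev g * ev g' = ev h * t ^+ e ->
  exists k u, unitP u /\ ev g = t ^+ k * u.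
Proof.
elim: e g h => [|e IH] g h h0 E.
  exists 0%N, (ev g); rewrite mul1r; split=> //; exists g, 1.
  rewrite !eval2_1 oner_neq0 divr1; split=> //.
  move: E; rewrite expr0 mulr1 -eval2M => /at_ev; rewrite eval2M => E.
  by apply: contra_neq h0 => g0; rewrite -E g0 mul0r.
have [g0|g0] := eqVneq (at_ g) 0; last first.
  exists 0%N, (ev g); rewrite mul1r; split=> //; exists g, 1.
  by rewrite !eval2_1 oner_neq0 divr1.
have [D [g1 [D0 gE]]] := vanish_factor g0.
have [||k [u [Pu g1E]]] := IH g1 (D * h); first by rewrite eval2M mulf_neq0.
  apply: (mulfI t_neq0); rewrite mulrA -gE -mulrA E eval2M exprS; ring.
exists k.+1, (u * (ev D)^-1); split.
  by apply: unitPM => //; apply: unitPV; exists D, 1; rewrite !eval2_1 oner_neq0 divr1.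
by apply: (mulfI (at_ev_neq0 D0)); rewrite gE g1E exprS; field; rewrite at_ev_neq0.
Qed.

End AffinePoint.

Lemma ev_norm g : ev g != 0 ->
  exists h (c : {poly K}), c != 0 /\ ev g * ev h = ev c%:P.
Proof.
move=> g0; have [sf _] := size_trace_norm_poly.
have [sg|sg] := leqP (size g) 1.
  exists 1, g`_0; rewrite eval2_1 mulr1; rewrite (size1_polyC sg) in g0 *.
  rewrite coefC eqxx; split=> //.
  by apply: contraNneq g0 => ->; rewrite polyC0 eval2_0.
have f1 : (1 < size f)%N by rewrite sf; lia.
have [[u v] /= [_ _ rE]] := resultant_in_ideal f1 sg.
exists v, (resultant f g); split; last first.
  have fE : ev f = 0 by apply/ev_ker; exists 1; rewrite mul1r.
  by rewrite rE eval2D !eval2M fE mulr0 add0r mulrC.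
rewrite resultant_eq0 -leqNgt leqNgt; apply/negP => /gtn_eqF/negbT.
have f0 : f != 0 by rewrite -size_poly_gt0; lia.
have gn0 : g != 0 by rewrite -size_poly_gt0; lia.
case/(Bezout_coprimepPn f0 gn0) => -[u' v'] /= /andP[_ /andP[v0 sv]] E.
have : ev v' * ev g = 0 by rewrite -eval2M -E; apply/ev_ker; exists u'.
move/eqP; rewrite mulf_eq0 (negPf g0) orbF => /eqP v'0.
have : v' = 0 by apply: ev_inj v'0; rewrite -ltnS -sf.
by move=> v'E; rewrite v'E size_poly0 in v0.
Qed.

Section AffinePlace.
Variables (a b : K).
Hypothesis Pab : Tr q n.+1 b = a ^+ m.
Notation at_ := (eval2 idfun b a).
Notation OP := (OP a b).
Notation unitP := (unitP a b).
Notation t := (x - iota a).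

Lemma at_C (c : {poly K}) : at_ c%:P = c.[a].
Proof. by rewrite eval2_idfun hornerC. Qed.

Lemma regular_order g : ev g != 0 -> exists k u, unitP u /\ ev g = t ^+ k * u.
Proof.
move=> g0; have [h [c [c0 E]]] := ev_norm g0.
have [e [c1]] := multiplicity_XsubC c a; rewrite c0 /= => c1a cE.
apply: (@point_order _ _ Pab e g h c1%:P).
  by rewrite at_C.
by rewrite E cE polyCM eval2M rmorphXn eval2Xn ev_t.
Qed.

Lemma place_order z : z != 0 ->
  exists k u, unitP u /\ (z = t ^+ k * u \/ z = u / t ^+ k).
Proof.
have t0 := t_neq0 a.
have [g [h [h0 ->]]] := ev_frac z; rewrite mulf_eq0 negb_or => /andP[g0 _].
have [k [u [Pu ->]]] := regular_order g0; have [l [v [Pv ->]]] := regular_order h0.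
have v0 := unitP_neq0 Pab Pv.
have Puv : unitP (u / v) by apply: unitPM => //; apply: unitPV.
have [lk|kl] := leqP l k.
  exists (k - l)%N, (u / v); split=> //; left.
  by rewrite -{1}(subnKC lk) exprD; field; rewrite v0 expf_neq0.
exists (l - k)%N, (u / v); split=> //; right.
by rewrite -{1}(subnKC (ltnW kl)) exprD; field; rewrite v0 !expf_neq0.
Qed.

Lemma valring_OP : valring iota OP.
Proof.
split; [|exact: OPD|exact: OPM|].
  by move=> c; rewrite -(eval2CC iota y x); apply: OP_ev.
move=> z nz; have [z0|/place_order[k [u [Pu E]]]] := eqVneq z 0.
  by case: nz; rewrite z0 -(eval2_0 iota y x); apply: OP_ev.
have [OPu OPuV] := unitP_OP Pu.
have OPt l : OP (t ^+ l) by rewrite -ev_t -eval2Xn; apply: OP_ev.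
case: E => E; first by case: nz; rewrite E; apply: OPM.
by rewrite E invf_div; apply: OPM.
Qed.

Lemma nonunit_ev g : at_ g = 0 -> nonunit OP (ev g).
Proof.
move=> g0; have [->|eg0] := eqVneq (ev g) 0; first by left.
right=> -[g' [h [h0 E]]]; move/eqP: (h0); apply.
rewrite (@at_ev _ _ Pab h (g' * g)) ?eval2M ?g0 ?mulr0 //.
by rewrite -[ev g'](divfK (at_ev_neq0 Pab h0)) -E mulrAC mulVf ?mul1r.
Qed.

Lemma nonunit_t : nonunit OP t.
Proof. by rewrite -ev_t; apply: nonunit_ev; rewrite at_C !hornerE subrr. Qed.

Lemma at_nonunit g : nonunit OP (ev g) -> at_ g = 0.
Proof.
move=> N; apply/eqP/negPn/negP => g0.
have : unitP (ev g) by exists g, 1; rewrite !eval2_1 oner_neq0 divr1.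
move=> Pg; have [_ /(nonunit_unit N) g1] := unitP_OP Pg.
by have := unitP_neq0 Pab Pg; rewrite g1 eqxx.
Qed.

End AffinePlace.

Lemma valring_affine O : valring iota O -> residually_trivial iota O -> O x ->
  exists a b, Tr q n.+1 b = a ^+ m /\ forall z, O z <-> OP a b z.
Proof.
move=> Ov Or Ox; have Oy := valring_x_y Ov Ox.
have [a Na] := Or x Ox; have [b Nb] := Or y Oy; exists a, b.
have Nat g : nonunit O (ev g - iota (eval2 idfun b a g)).
  have [g1 [g2 gE]] := at_factor a b g.
  rewrite {1}gE !eval2D !eval2M ev_t eval2B eval2X !eval2CC -!addrA addrC addrA addrNK.
  have Oev h : O (ev h) by exact: (valring_eval2 Ov).
  by apply: (nonunitD Ov); apply: (nonunitMl Ov).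
have Pab : Tr q n.+1 b = a ^+ m.
  apply/eqP; rewrite -subr_eq0; apply/eqP/(nonunitC Ov).
  have fE : ev f = 0 by apply/ev_ker; exists 1; rewrite mul1r.
  have := nonunitN Ov (Nat f); rewrite fE opprB subr0.
  by rewrite /trace_norm_poly polyC_exp eval2B eval2Xn eval2_Tr eval2X eval2Y.
split=> // z.
have OPO w : OP a b w -> O w.
  move=> [g [h [h0 ->]]]; apply: (valringM Ov); first exact: (valring_eval2 Ov).
  by rewrite -(subrKC (iota (eval2 idfun b a h)) (ev h)); apply: (unit_addC Ov).
split=> [Oz|]; last exact: OPO.
apply: contrapT => nz; have := valring_OP Pab.
have z0 : z != 0.
  by apply/eqP => z0; apply: nz; rewrite z0; apply: (valring0 (valring_OP Pab)).
have [k [u [Pu [E|E]]]] := place_order Pab z0 => [_|_].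
  apply: nz; rewrite E; apply: OPM; last by have [] := unitP_OP Pu.
  by rewrite -ev_t -eval2Xn; apply: OP_ev.
have [k0|k0] := posnP k.
  by apply: nz; rewrite E k0 expr0 divr1; have [] := unitP_OP Pu.
have t0 := t_neq0 a.
have uE : u = z * (x - iota a) ^+ k by rewrite E divfK // expf_neq0.
have Nu : nonunit O u.
  by rewrite uE; apply: (nonunitMl Ov) => //; apply: (nonunitX Ov).
have [_ /OPO/(nonunit_unit Nu) u0] := unitP_OP Pu.
by have := unitP_neq0 Pab Pu; rewrite u0 eqxx.
Qed.

Lemma OP_inj a b a' b' : Tr q n.+1 b = a ^+ m -> Tr q n.+1 b' = a' ^+ m ->
  (forall z, OP a b z <-> OP a' b' z) -> a = a' /\ b = b'.
Proof.
move=> P P' E.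
have EN g : eval2 idfun b a g = 0 -> eval2 idfun b' a' g = 0.
  move=> g0; apply: (at_nonunit P'); case: (nonunit_ev P g0); [by left|].
  by move=> h; right => /E.
have := EN ('X - a%:P)%:P; rewrite !at_C !hornerE subrr => /(_ erefl)/eqP.
rewrite subr_eq0 => /eqP ->.
have := EN ('X - b%:P%:P); rewrite !eval2B !eval2X !eval2CC subrr => /(_ erefl)/eqP.
by rewrite subr_eq0 => /eqP ->.
Qed.

Lemma at_horner a b (g : {poly {poly K}}) :
  eval2 idfun b a g = (map_poly (horner_eval a) g).[b].
Proof.
have := horner_map (horner_eval a) g b%:P.
by rewrite /= !horner_evalE hornerC eval2_idfun.
Qed.

Lemma fibre (a : K) : exists rs, [/\ uniq rs, size rs = d
  & forall b, (b \in rs) = (Tr q n.+1 b == a ^+ m)].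
Proof. by apply: (trace_roots _ pK pq) => //; apply: ltnW. Qed.

Lemma vanish_fibre a (g : {poly {poly K}}) : (size g <= d)%N ->
  (forall b, Tr q n.+1 b = a ^+ m -> eval2 idfun b a g = 0) ->
  exists g', g = ('X - a%:P)%:P * g'.
Proof.
move=> sg g0; have [rs [u srs mem]] := fibre a.
have G0 : map_poly (horner_eval a) g = 0.
  apply: (@roots_geq_poly_eq0 _ _ rs) => //.
    apply/allP => b; rewrite mem => /eqP Pb.
    by rewrite rootE -at_horner g0.
  by rewrite srs (leq_trans (size_poly _ _)).
exists (\poly_(j < size g) (g`_j %/ ('X - a%:P))); apply/polyP => j.
rewrite coefCM coef_poly; case: ltnP => [_|sj]; last by rewrite mulr0 nth_default.
rewrite mulrC divpK // dvdp_XsubCl rootE -horner_evalE.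
by rewrite -coef_map_id0 ?G0 ?coef0 ?eqxx // horner_evalE horner0.
Qed.

Lemma ev_reduce g : exists2 g' : {poly {poly K}}, (size g' <= d)%N & ev g = ev g'.
Proof.
by have [N /wspan_redspan[g' [sg' _] ->]] := ev_wspan g; exists g'.
Qed.

(* By induction on a denominator c in K[x]: at a root a of c, the numerator
   vanishes on the whole fibre over a, hence is divisible by x - a. *)
Lemma regularP z :
  (forall a b, Tr q n.+1 b = a ^+ m -> OP a b z) -> exists g, z = ev g.
Proof.
move=> Oz; have [g [h [h0 zE]]] := ev_frac z.
have [h' [c [c0 hE]]] := ev_norm h0.
have : ev c%:P * z = ev (g * h').
  by rewrite -hE zE eval2M; field.
move: (g * h') => g0; move: c0 {g h h' h0 zE hE}; move: g0 => g.
have [k] := ubnP (size c); elim: k c g => // k IH c g sc c0 cz.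
have [c1|c1] := leqP (size c) 1.
  have cE := size1_polyC c1; set a := c`_0 in cE.
  have a0 : a != 0 by move: c0; rewrite cE polyC_eq0.
  exists (a^-1%:P%:P * g); rewrite eval2M -cz cE !eval2CC mulrA -rmorphM mulVf //.
  by rewrite rmorph1 mul1r.
have /closed_rootP[a ra] : size c != 1%N by rewrite neq_ltn c1 orbT.
have /factor_theorem[c' cE] := ra.
have [g' sg' gE] := ev_reduce g.
have [b Pb|g1 g1E] := @vanish_fibre a g' sg'.
  have [g2 [h [h0 zE]]] := Oz a b Pb.
  have : ev (c%:P * g2) = ev (g' * h).
    rewrite !eval2M -gE -cz zE -mulrA divfK //; exact: (at_ev_neq0 Pb).
  move/(at_ev Pb)/eqP; rewrite !eval2M at_C (eqP ra) mul0r eq_sym mulf_eq0 (negPf h0) orbF.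
  by move/eqP.
have c'0 : c' != 0 by apply: contraNneq c0 => c'0; rewrite cE c'0 mul0r.
apply: (IH c' g1) => //.
  by move: sc; rewrite cE size_Mmonic ?monicXsubC // size_XsubC; lia.
apply: (mulfI (t_neq0 a)); rewrite -ev_t -[in RHS]eval2M -g1E -gE -cz cE polyCM eval2M.
by ring.
Qed.

(** * Every automorphism fixes the place at infinity *)

Lemma Oinf_deg N M g h : hasdeg N g -> hasdeg M h -> Oinf (g / h) -> (N <= M)%N.
Proof.
move=> Hg Hh [L [g1 [h1 [V H1 /eqP]]]].
rewrite eqr_div ?(hasdeg_neq0 Hh) ?(hasdeg_neq0 H1) // => /eqP E.
have := hasdeg_lt (hasdegM Hg H1); rewrite E => /(_ _ (wspanM V (hasdeg_wspan Hh))).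
lia.
Qed.

Lemma valring_Kaut_Oinf (s : Kaut iota) O : valring iota O -> ~ O (s x) ->
  forall z, O z <-> Oinf ((s^-1)%g z).
Proof.
move=> Ov nO z; rewrite -(valring_eq_Oinf (valring_Kaut s Ov) nO) /=.
by rewrite KautKV.
Qed.

(* If s pulls the place at infinity back to an affine place (a, b), then
   u = s^-1 x has its only pole there, of order k <= d; hence (x - a)^k u lies in
   K[x, y] and has pole order at most d^2 < m(d - 1), so degree at most d - 2
   in y, while it vanishes at the d - 1 other points of the fibre over a. *)
Lemma Kaut_Oinf (s : Kaut iota) z : Oinf (s z) <-> Oinf z.
Proof.
have Ov := valring_Kaut s valring_Oinf.
have [Ox|nOx] := pselect (Oinf (s x)); last exact: (valring_eq_Oinf Ov nOx).
exfalso; have Or : residually_trivial iota (fun z => Oinf (s z)).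
  move=> w /residually_trivial_Oinf[c Nc]; exists c; apply/nonunit_Kaut.
  by rewrite rmorphB /= KautC.
have [a [b [Pab OE]]] := valring_affine Ov Or Ox.
have {}OE w : Oinf (s w) <-> OP a b w := OE w.
have OPv := valring_OP Pab.
pose u := (s^-1)%g x.
have su : s u = x by rewrite /u KautKV.
have nu : ~ OP a b u by move/OE; rewrite su; apply: Oinf_x.
have hP a' b' : Tr q n.+1 b' = a' ^+ m -> (a', b') <> (a, b) -> OP a' b' u.
  move=> P' ne; apply: contrapT => nO; apply: ne.
  have E w : OP a b w <-> OP a' b' w.
    by rewrite (valring_Kaut_Oinf (valring_OP P') nO) -OE invgK.
  by have [-> ->] := OP_inj Pab P' E.
have Ou : Oinf u.
  apply: contrapT => nO; apply: Oinf_x; apply/(valring_Kaut_Oinf valring_Oinf nO).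
  by rewrite invgK.
have u0 : u != 0.
  by apply/eqP => u0; apply: nu; rewrite u0; apply: (valring0 OPv).
have OPt k a' b' : OP a' b' ((x - iota a) ^+ k) by rewrite -ev_t -eval2Xn; apply: OP_ev.
have [k [w [Pw [uE|uE]]]] := place_order Pab u0.
  by apply: nu; rewrite uE; apply: OPM => //; have [] := unitP_OP Pw.
have [OPw OPwV] := unitP_OP Pw; have w0 := unitP_neq0 Pab Pw.
have k0 : (0 < k)%N.
  by case: (k) uE => // uE; case: nu; rewrite uE expr0 divr1.
have t0 := t_neq0 a; set t := x - iota a in OPt uE t0.
have wE : w = t ^+ k * u by rewrite uE mulrC divfK // expf_neq0.
have kd : (k <= d)%N.
  have st0 : s t != 0 by rewrite fmorph_eq0.
  have /minfP[N [g [h [Vg Hh stE]]]] : nonunit Oinf (s t).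
    apply/nonunit_Kaut; case: (nonunit_t Pab) => [|h]; [by left|right].
    by move/OE.
  have [g0|[l lN Hg]] := wspan_deg Vg; first by rewrite stE g0 mul0r eqxx in st0.
  have sw0 : s w != 0 by rewrite fmorph_eq0.
  have [g' [h' [e [e' [Hg' Hh' swE]]]]] := frac_deg sw0.
  have ee' : e = e'.
    apply/eqP; rewrite eqn_leq (Oinf_deg Hg' Hh') -?swE ?(Oinf_deg Hh' Hg') //.
      by rewrite -invf_div -swE -fmorphV; apply/OE.
    exact/OE.
  have E : x * g ^+ k * h' = g' * h ^+ k.
    have := congr1 s wE; rewrite rmorphM rmorphXn /= su stE swE => E.
    have h0 := hasdeg_neq0 Hh; have h'0 := hasdeg_neq0 Hh'.
    rewrite -[g'](divfK h'0) E expr_div_n; field.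
    by rewrite expf_neq0.
  have := hasdegM (hasdegM hasdeg_x (hasdegX k Hg)) Hh'.
  rewrite E => /hasdeg_inj/(_ (hasdegM Hg' (hasdegX k Hh))).
  by rewrite -ee'; nia.
have [G0 G0E] : exists g, w = ev g.
  apply: regularP => a' b' P'; have [[-> ->] //|ne] := pselect ((a', b') = (a, b)).
  by rewrite wE; apply: OPM => //; apply: hP.
have Vw : wspan (d * d).+1 w.
  case: Ou => [N [g [h [Vg Hh uE']]]].
  have [l Hl] : exists l, hasdeg l w by rewrite G0E; apply: ev_deg; rewrite -G0E.
  have Vt : wspan (k * d).+1 (t ^+ k).
    by apply: wspanX; apply: wspanB; [apply: wspan_x|apply: (wspan_le _ (wspanC 0 a))].
  have := hasdeg_lt (hasdegM Hl Hh); have -> : w * h = g * t ^+ k.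
    by rewrite wE uE' -mulrA divfK ?(hasdeg_neq0 Hh) // mulrC.
  move=> /(_ _ (wspanM Vg Vt)) lk; apply: (wspan_le _ (hasdeg_wspan Hl)).
  by nia.
have [g [sg Vg] gE] := wspan_redspan Vw.
have sg1 : (size g <= d.-1)%N.
  apply/leq_sizeP => j dj; apply/polyP => i; rewrite coef0; apply/eqP/negPn/negP.
  by move/Vg; nia.
have [rs [urs srs mem]] := fibre a.
have brs : b \in rs by rewrite mem Pab.
pose G := map_poly (horner_eval a) g.
have G_0 : G = 0.
  apply: (@roots_geq_poly_eq0 _ _ (rem b rs)); last 2 first.
  - exact: rem_uniq.
  - by rewrite size_rem // srs (leq_trans (size_poly _ _)).
  apply/allP => b'; rewrite (mem_rem_uniq _ urs) !inE mem => /andP[b'b /eqP P'].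
  rewrite rootE -at_horner (at_nonunit P') // -gE wE.
  apply: (nonunitM (valring_OP P')); last first.
    by apply: hP => // -[bb]; rewrite bb eqxx in b'b.
  by apply: (nonunitX (valring_OP P')) => //; apply: nonunit_t.
have /(nonunit_ev Pab) Nw : eval2 idfun b a g = 0 by rewrite at_horner -/G G_0 horner0.
by move/eqP: w0; apply; apply: (nonunit_unit _ OPwV); rewrite gE.
Qed.

Lemma Kaut_regular (s : Kaut iota) g : exists h, s (ev g) = ev h.
Proof.
apply: regularP => a b P; have Ov := valring_OP P.
have Osx : OP a b (s x).
  apply: contrapT => nO; apply: Oinf_x.
  rewrite -(Kaut_Oinf (s^-1)%g); apply/(valring_Kaut_Oinf Ov nO).
  by rewrite -(eval2Y iota y x); apply: OP_ev.
have Ov' := valring_Kaut s Ov; have Osy := valring_x_y Ov' Osx.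
exact: (valring_eval2 Ov').
Qed.

Lemma wspan_const z : wspan d z -> exists c, z = iota c.
Proof.
elim=> [|c i j _ lt_d _ [c' ->]]; first by exists 0; rewrite rmorph0.
exists (c + c'); rewrite rmorphD.
have -> : i = 0%N by nia.
by have -> : j = 0%N by [nia]; rewrite !mulr1.
Qed.

Lemma wspan_linear z : wspan m z -> exists a b, z = iota a * x + iota b.
Proof.
elim=> [|c i j _ lt_m _ [a [b ->]]]; first by exists 0, 0; rewrite rmorph0 mul0r addr0.
have -> : j = 0%N by nia.
have [->|->] : i = 0%N \/ i = 1%N by nia.
  by exists a, (c + b); rewrite rmorphD !mulr1 addrCA.
by exists (c + a), b; rewrite rmorphD mulr1 addrA mulrDl.
Qed.

Lemma linear_wspan a b : wspan m (iota a * x + iota b).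
Proof.
apply: wspanD; last by apply: (wspan_le _ (wspanC 0 b)); lia.
by apply: wspanZ; apply: (wspan_le _ wspan_x); lia.
Qed.

Lemma wspan_affine z :
  wspan m.+1 z -> exists a b c, z = iota a * y + iota b * x + iota c.
Proof.
case/wspan_top => [/wspan_linear[b [c ->]]|].
  by exists 0, b, c; rewrite rmorph0 mul0r add0r.
move=> [a [i [j [_ wE /wspan_linear[b [c E]]]]]].
have [j1 i0] : j = 1%N /\ i = 0%N.
  case: j wE E => [|[|j]] wE E; last by nia.
    have : coprime d m by apply: coprime_norm_exp.
    by move: wE; rewrite muln0 addn0 => <-; rewrite /coprime gcdnMr; lia.
  by split=> //; nia.
exists a, b, c; rewrite -addrA -E j1 i0 mulr1 expr1.
by rewrite [RHS]addrC subrK.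
Qed.

Lemma Kaut_x (s : Kaut iota) : exists a b, s x = iota a * x + iota b.
Proof.
have [g gE] := Kaut_regular s 'X%:P; rewrite eval2Y in gE.
have [h hE] := Kaut_regular (s^-1)%g 'X%:P; rewrite eval2Y in hE.
apply: wspan_linear; apply: (@wspan_le d.+1); first by lia.
have sx0 : s x != 0 by rewrite fmorph_eq0 x_neq0.
have h0 : ev h != 0 by rewrite -hE fmorph_eq0 x_neq0.
have [e He] : exists e, hasdeg e (s x) by rewrite gE; apply: ev_deg; rewrite -gE.
have [e' He'] := ev_deg h0.
apply: (wspan_le _ (hasdeg_wspan He)); rewrite ltnS.
apply: (Oinf_deg He hasdeg_x).
have -> : s x / x = s (x / ev h) by rewrite fmorph_div /= -hE KautKV.
apply/Kaut_Oinf; exists e', x, (ev h); split=> //.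
apply: (wspan_le _ wspan_x); rewrite ltnS leqNgt; apply/negP => e'd.
have [c hc] : exists c, ev h = iota c.
  by apply: wspan_const; apply: (wspan_le _ (hasdeg_wspan He')).
apply: Oinf_x; rewrite -(KautKV s x) hE hc KautC.
exact: (valringC valring_Oinf).
Qed.

Lemma hasdeg_y : hasdeg m y.
Proof.
have := hasdeg_mono 0 1 (oner_neq0 K).
by rewrite rmorph1 !mul1r muln0 muln1.
Qed.

Lemma Kaut_y (s : Kaut iota) : exists a b c, s y = iota a * y + iota b * x + iota c.
Proof.
have [g gE] := Kaut_regular s 'X; rewrite eval2X in gE.
have [h hE] := Kaut_regular (s^-1)%g 'X; rewrite eval2X in hE.
apply: wspan_affine; have y0 := hasdeg_neq0 hasdeg_y.
have sy0 : s y != 0 by rewrite fmorph_eq0.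
have h0 : ev h != 0 by rewrite -hE fmorph_eq0.
have [e He] : exists e, hasdeg e (s y) by rewrite gE; apply: ev_deg; rewrite -gE.
have [e' He'] := ev_deg h0.
apply: (wspan_le _ (hasdeg_wspan He)); rewrite ltnS.
apply: (Oinf_deg He hasdeg_y).
have -> : s y / y = s (y / ev h) by rewrite fmorph_div /= -hE KautKV.
apply/Kaut_Oinf; exists e', y, (ev h); split=> //.
apply: (wspan_le _ wspan_y); rewrite ltnS leqNgt; apply/negP => e'm.
have [a [b hc]] : exists a b, ev h = iota a * x + iota b.
  by apply: wspan_linear; apply: (wspan_le _ (hasdeg_wspan He')).
apply: (hasdeg_notin hasdeg_y); rewrite -(KautKV s y) hE hc rmorphD rmorphM /= !KautC.
have [a' [b' ->]] := Kaut_x s.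
rewrite mulrDr mulrA -addrA -!rmorphM -rmorphD; exact: linear_wspan.
Qed.

(** * Determination of the automorphism group *)

Lemma Kaut_ext (s s' : Kaut iota) : s x = s' x -> s y = s' y -> s = s'.
Proof.
move=> Ex Ey; apply: Kaut_inj => z; have [g [h [_ ->]]] := ev_frac z.
by rewrite !fmorph_div /= !Kaut_eval2 Ex Ey.
Qed.

Lemma norm_expXq (a : K) : a ^+ (q ^ n.+1) = a -> a != 0 -> (a ^+ m) ^+ q = a ^+ m.
Proof.
move=> aq a0; rewrite -exprM -[q in (m * q)%N](subnK (ltnW q_gt1)) mulnDr muln1.
have qn0 : (0 < q ^ n.+1)%N by rewrite expn_gt0 ltnW.
rewrite exprD norm_expM //; apply: (mulIf a0).
by rewrite mulrAC -exprSr subn1 prednK // aq mulrC.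
Qed.

Lemma Kaut_ex (a e : K) : a ^+ (q ^ n.+1) = a -> a != 0 -> Tr q n.+1 e = 0 ->
  exists s : Kaut iota, s x = iota a * x /\ s y = iota (a ^+ m) * y + iota e.
Proof.
move=> aq a0 e0; set c := a ^+ m.
have c0 : c != 0 by rewrite expf_neq0.
have cq : c ^+ q = c := norm_expXq aq a0.
have pF : p \in [pchar F] by rewrite (fmorph_pchar iota).
set x' := iota a * x; set y' := iota c * y + iota e.
have f' : eval2 iota y' x' f = 0.
  rewrite /trace_norm_poly polyC_exp eval2B eval2Xn eval2_Tr eval2X eval2Y.
  rewrite /y' (TrD pF pq) -Tr_rmorph e0 rmorph0 addr0 Tr_scale // trace_normE.
  by rewrite /x' exprMn -rmorphXn subrr.
have inv g : exists g1, forall u v,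
    eval2 iota u v g1 = eval2 iota (iota c^-1 * u + iota (- c^-1 * e)) (iota a^-1 * v) g.
  exact: eval2_affine_subst.
have sx : iota a^-1 * x' = x.
  by rewrite /x' mulrA -rmorphM mulVf // rmorph1 mul1r.
have sy : iota c^-1 * y' + iota (- c^-1 * e) = y.
  rewrite /y' mulrDr mulrA -!rmorphM mulVf // rmorph1 mul1r -addrA -rmorphD.
  by rewrite -mulrDl addrN mul0r rmorph0 addr0.
have [||z|s [sy' sx']] := @Kaut_of_eval2 K F iota y x y' x'; last by exists s.
- move=> g; split=> [/ev_ker[h ->]|g0]; first by rewrite eval2M f' mulr0.
  have [g1 g1E] := eval2_affine_subst iota c e a g.
  have /ev_ker[h hE] : ev g1 = 0 by rewrite g1E.
  pose u := iota c^-1 * (y - iota e); pose v := iota a^-1 * x.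
  have -> : ev g = eval2 iota u v g1.
    rewrite g1E /u /v !mulrA -!rmorphM !mulfV // rmorph1 !mul1r subrK.
    by [].
  rewrite hE eval2M; apply/eqP; rewrite mulf_eq0; apply/orP; right; apply/eqP.
  rewrite /trace_norm_poly polyC_exp eval2B eval2Xn eval2_Tr eval2X eval2Y.
  rewrite /u /v Tr_scale ?exprVn ?cq // (TrB pF pq) -Tr_rmorph e0.
  by rewrite rmorph0 subr0 trace_normE exprMn -rmorphXn exprVn subrr.
- by move=> z; apply: ev_frac.
have [g [h [h0 zE]]] := ev_frac z; have [g1 g1E] := inv g; have [h1 h1E] := inv h.
by exists g1, h1; rewrite g1E h1E sx sy.
Qed.

Lemma Kaut_form (s : Kaut iota) : exists a e,
  [/\ a ^+ (q ^ n.+1) = a, a != 0, Tr q n.+1 e = 0, s x = iota a * x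
    & s y = iota (a ^+ m) * y + iota e].
Proof.
have [a [b sx]] := Kaut_x s; have [c [k [e sy]]] := Kaut_y s.
have a0 : a != 0.
  apply/eqP => a0; apply: Oinf_x; rewrite -(KautK s x) sx a0 rmorph0 mul0r add0r KautC.
  exact: (valringC valring_Oinf).
have pX : p \in [pchar {poly K}] by rewrite pchar_poly.
pose P : {poly K} := k%:P * 'X + e%:P.
pose A : {poly K} := a%:P * 'X + b%:P.
pose C : {poly K} := Tr q n.+1 P - A ^+ m + (c ^+ d)%:P * 'X^m.
pose H : {poly {poly K}} := \sum_(i < n) (c ^+ (q ^ i) - c ^+ d)%:P%:P * 'X^(q ^ i) + C%:P.
have H0 : H = 0.
  apply: ev_inj.
    rewrite /H (leq_trans (size_polyD _ _)) // geq_max.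
    rewrite (leq_trans (size_polyC_leq1 _)) ?andbT; last by lia.
    apply: (leq_trans (size_sum _ _ _)); apply/bigmax_leqP => i _.
    rewrite mul_polyC (leq_trans (size_scale_leq _ _)) //.
    by rewrite size_polyXn q_exp_lt.
  have EP : ev P%:P = iota k * x + iota e.
    by rewrite polyCD polyCM eval2D eval2M eval2Y !eval2CC.
  have EA : ev A%:P = iota a * x + iota b.
    by rewrite polyCD polyCM eval2D eval2M eval2Y !eval2CC.
  have pF : p \in [pchar F] by rewrite (fmorph_pchar iota).
  have EC : ev C%:P = Tr q n.+1 (iota k * x + iota e) - (iota a * x + iota b) ^+ m
                      + iota c ^+ d * x ^+ m.
    rewrite /C polyCD polyCB polyCM !(polyC_exp m) eval2D eval2B eval2M.
    have -> : (Tr q n.+1 P)%:P = Tr q n.+1 P%:P := Tr_rmorph polyC q n.+1 P.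
    rewrite eval2_Tr EP !eval2Xn EA eval2Y eval2CC.
    by rewrite (rmorphXn iota).
  have ES : ev (\sum_(i < n) (c ^+ (q ^ i) - c ^+ d)%:P%:P * 'X^(q ^ i)) =
      Tr q n (iota c * y) - iota c ^+ d * \sum_(i < n) y ^+ (q ^ i).
    rewrite (raddf_sum (eval2 iota y x)) mulr_sumr -sumrB; apply: eq_bigr => i _ /=.
    rewrite eval2M eval2CC eval2Xn eval2X rmorphB mulrBl exprMn !rmorphXn.
    by [].
  rewrite /H eval2D ES EC.
  have := congr1 s trace_normE; rewrite (Tr_rmorph s) rmorphXn /= sx sy -addrA.
  rewrite (TrD pF pq) Tr_recr exprMn y_expd => <-.
  by ring.
have [cE C0] : (forall l, (l < n)%N -> c ^+ (q ^ l) = c ^+ d) /\ C = 0.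
  split=> [l ln|].
    have := congr1 (fun w : {poly {poly K}} => w`_(q ^ l)) H0.
    rewrite /H coefD coefC expn_eq0 eqn0Ngt (ltnW q_gt1) /= addr0 coef0 coef_sum.
    rewrite (bigD1 (Ordinal ln)) //= big1 ?addr0 => [|i il].
      rewrite coefCM coefXn eqxx mulr1 => /polyC_inj/eqP.
      by rewrite subr_eq0 => /eqP.
    rewrite coefCM coefXn eqn_exp2l // (_ : (l == i) = false) ?mulr0 //.
    by apply: contraNF il => /eqP li; apply/eqP/val_inj.
  have := congr1 (fun w : {poly {poly K}} => w`_0) H0.
  rewrite /H coefD coefC eqxx coef0 coef_sum big1 ?add0r // => i _.
  by rewrite coefCM coefXn eq_sym expn_eq0 eqn0Ngt (ltnW q_gt1) mulr0.
have cd : c ^+ d = c by rewrite -(cE 0%N) // ltnW.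
have Tr_hi l : (d < l)%N -> (Tr q n.+1 P)`_l = 0.
  move=> dl; apply: nth_default; apply: leq_trans (size_sum _ _ _) _.
  apply/bigmax_leqP => i _; apply: leq_trans (size_poly_exp_leq _ _) _.
  have sP : ((size P).-1 <= 1)%N.
    rewrite -(subn1 (size P)) leq_subLR (leq_trans (size_polyD _ _)) // geq_max.
    rewrite (leq_trans (size_polyC_leq1 _)) // andbT mul_polyC.
    by rewrite (leq_trans (size_scale_leq _ _)) // size_polyX.
  have := ltn_ord i; rewrite ltnS -(leq_exp2l _ _ q_gt1) => qi; have := leq_mul sP (leqnn (q ^ i)).
  by rewrite mul1n => /leq_ltn_trans; apply; apply: leq_ltn_trans dl.
(* The coefficient of 'X^(m - 1): it is out of reach of the trace as d < m - 1. *)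
have b0 : b = 0.
  have := congr1 (fun w : {poly K} => w`_(m - 1)) C0.
  rewrite /C coefD coefB Tr_hi; last by lia.
  rewrite coef_affine_exp ?coefCM ?coefXn ?coef0; last by lia.
  rewrite (_ : (m - 1 == m)%N = false); last by lia.
  rewrite mulr0 addr0 sub0r bin1 expr1 => /eqP; rewrite oppr_eq0.
  have m1 : m%:R = 1 :> K.
    by rewrite norm_exp_recl // -addn1 natrD natrM (natr_pchar_eq0 pK pq) // mulr0 add0r.
  by rewrite -mulr_natr m1 mulr1 mulf_eq0 expf_eq0 (negPf a0) andbF => /eqP.
have cam : c = a ^+ m.
  have := congr1 (fun w : {poly K} => w`_m) C0.
  rewrite /C coefD coefB Tr_hi; last by lia.
  have := coef_affine_exp a b (leq0n m); rewrite subn0 bin0 expr0 mulr1n mulr1 => ->.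
  rewrite coefCM coefXn eqxx coef0 mulr1 sub0r cd addrC => /eqP.
  by rewrite subr_eq0 => /eqP.
have TrP : Tr q n.+1 P = 0.
  move: C0; rewrite /C /A b0 addr0 exprMn -polyC_exp cd -cam => <-.
  by rewrite subrK.
have k0 : k = 0.
  have := congr1 (fun w : {poly K} => w`_1) TrP.
  rewrite (TrD pX pq) coefD -Tr_rmorph coefC addr0 coef0 coef_sum.
  rewrite big_ord_recl big1 ?addr0 => [|i _].
    by rewrite expn0 expr1 coefCM coefX mulr1.
  rewrite exprMn -polyC_exp coefCM coefXn lift0 (_ : (1 == q ^ i.+1)%N = false) ?mulr0 //.
  by apply/negbTE; rewrite neq_ltn -[X in (X < _)%N](expn0 q) ltn_exp2l.
have e0 : Tr q n.+1 e = 0.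
  by move: TrP; rewrite /P k0 mul0r add0r -Tr_rmorph => /eqP; rewrite polyC_eq0 => /eqP.
exists a, e; split=> //; last by rewrite sy k0 rmorph0 mul0r addr0 cam.
  have am : a ^+ (m * (q - 1)) = 1.
    apply: (mulIf (_ : a ^+ m != 0)); first by rewrite expf_neq0.
    rewrite -exprD mul1r -{2}(muln1 m) -mulnDr subnK ?(ltnW q_gt1) //.
    by rewrite exprM -cam -[in RHS]cd -(cE 1%N).
  have qn0 : (0 < q ^ n.+1)%N by rewrite expn_gt0 ltnW.
  by rewrite -(subnK qn0) -norm_expM // exprD am mul1r expr1.
by rewrite sx b0 rmorph0 addr0.
Qed.

Notation G := (groupG iota q n.+1 x y).
Notation H := (groupC iota q n.+1 x y).

Lemma Kaut_params_inj (a a' e e' : K) :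
  iota a * x = iota a' * x ->
  iota (a ^+ m) * y + iota e = iota (a' ^+ m) * y + iota e' -> a = a' /\ e = e'.
Proof.
move=> /(mulIf x_neq0)/fmorph_inj <- /addrI/fmorph_inj <-.
by [].
Qed.

Lemma Tr_scaleK (a e : K) : a ^+ (q ^ n.+1) = a -> a != 0 ->
  Tr q n.+1 (a ^+ m * e) = a ^+ m * Tr q n.+1 e.
Proof. by move=> aq a0; apply: (Tr_scale idfun); apply: norm_expXq. Qed.

(* Raising Tr e = 0 to the q-th power shifts the trace by e^(q^r) - e. *)
Lemma Tr0_fixed (e : K) : Tr q n.+1 e = 0 -> e ^+ (q ^ n.+1) = e.
Proof.
move=> e0; have: Tr q n.+1 (e ^+ q) = 0.
  have <- : Tr q n.+1 e ^+ q = Tr q n.+1 (e ^+ q); last by rewrite e0 expr0n eqn0Ngt ltnW.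
  rewrite /Tr -[q in LHS]expn1; elim/big_rec2: _ => [|i u v _ <-].
    by rewrite expn1 expr0n eqn0Ngt ltnW.
  by rewrite (exprD_q pK pq) expn1 -!exprM mulnC.
have E1 : Tr q n.+1 (e ^+ q) = \sum_(i < n) e ^+ (q ^ i.+1) + e ^+ (q ^ n.+1).
  rewrite Tr_recr -exprM -expnS; congr (_ + _).
  by apply: eq_bigr => i _; rewrite -exprM -expnS.
have E2 : Tr q n.+1 e = e + \sum_(i < n) e ^+ (q ^ i.+1) by rewrite /Tr big_ord_recl.
rewrite E1 => /eqP; move: E2; rewrite e0 addr_eq0 addrC => /esym/eqP.
by rewrite addr_eq0 => /eqP -> /eqP/oppr_inj.
Qed.

Lemma groupC_ex (a : K) : a ^+ (q ^ n.+1) = a -> a != 0 ->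
  exists2 s : Kaut iota, H s & s x = iota a * x /\ s y = iota (a ^+ m) * y.
Proof.
move=> aq a0; have [|s [sx sy]] := @Kaut_ex a 0 aq a0.
  by rewrite /Tr big1 // => i _; rewrite expr0n expn_eq0 eqn0Ngt (ltnW q_gt1).
by rewrite rmorph0 addr0 in sy; exists s => //; exists a.
Qed.

Lemma groupG_ex (e : K) : Tr q n.+1 e = 0 ->
  exists2 s : Kaut iota, G s & s x = x /\ s y = y + iota e.
Proof.
move=> e0; have [||s [sx sy]] := @Kaut_ex 1 e _ _ e0; rewrite ?expr1n ?oner_neq0 //.
rewrite expr1n rmorph1 !mul1r in sx sy; exists s => //; exists e; split=> //.
exact: Tr0_fixed.
Qed.

Lemma groupG_closed : group_closed [in G].
Proof.
split=> [|s t]; rewrite !(inE, unfold_in) /=.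
  exists 0; rewrite rmorph0 addr0; split=> //.
    by rewrite /Fsub /= expr0n expn_eq0 eqn0Ngt (ltnW q_gt1).
  by rewrite /Tr big1 // => i _; rewrite expr0n expn_eq0 eqn0Ngt (ltnW q_gt1).
move=> [a [aq a0 sx sy]] [b [bq b0 tx ty]].
have tVx : (t^-1)%g x = x by rewrite -{1}tx KautK.
have tVy : (t^-1)%g y = y - iota b.
  by apply: (can_inj (KautK t)); rewrite KautKV rmorphB /= ty KautC addrK.
have ab0 : Tr q n.+1 (a - b) = 0 by rewrite (TrB pK pq) a0 b0 subrr.
exists (a - b); split=> //; first exact: Tr0_fixed.
  by rewrite -[LHS]/(s ((t^-1)%g x)) tVx.
by rewrite -[LHS]/(s ((t^-1)%g y)) tVy rmorphB /= sy KautC rmorphB addrA.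
Qed.

Lemma groupC_closed : group_closed [in H].
Proof.
split=> [|s t]; rewrite !(inE, unfold_in) /=.
  by exists 1; rewrite /Fsub /= !expr1n rmorph1 !mul1r oner_neq0.
move=> [a [aq a0 sx sy]] [b [bq b0 tx ty]].
have ib0 : iota b != 0 by rewrite fmorph_eq0.
have tVx : (t^-1)%g x = iota b^-1 * x.
  apply: (can_inj (KautK t)).
  by rewrite KautKV rmorphM /= tx KautC mulrA -rmorphM mulVf // rmorph1 mul1r.
have tVy : (t^-1)%g y = iota (b^-1 ^+ m) * y.
  apply: (can_inj (KautK t)).
  rewrite KautKV rmorphM /= ty KautC mulrA -rmorphM exprVn mulVf ?expf_neq0 //.
  by rewrite rmorph1 mul1r.
exists (a / b); split.
- by move: aq bq; rewrite /Fsub /= exprMn exprVn => -> ->.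
- by rewrite mulf_neq0 // invr_eq0.
- rewrite -[LHS]/(s ((t^-1)%g x)) tVx (rmorphM s) /= sx KautC mulrA -rmorphM.
  by rewrite [b^-1 * a]mulrC.
rewrite -[LHS]/(s ((t^-1)%g y)) tVy (rmorphM s) /= sy KautC mulrA -rmorphM.
by rewrite exprMn [b^-1 ^+ m * _]mulrC.
Qed.

Lemma groupG_groupC_semidirect : is_semidirect_product G H.
Proof.
split; [exact: groupG_closed|exact: groupC_closed| | |].
- move=> nu s [a [aq a0 nx ny]]; have [b [e [bq b0 e0 sx sy]]] := Kaut_form s.
  have cE : (s^-1)%g (s y + iota (b ^+ m * a)) = y + iota (b ^+ m * a).
    by apply: (can_inj (KautK s)); rewrite KautKV rmorphD /= KautC.
  have T0 : Tr q n.+1 (b ^+ m * a) = 0 by rewrite Tr_scaleK // a0 mulr0.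
  exists (b ^+ m * a); split=> //; first exact: Tr0_fixed.
    rewrite -[LHS]/((s^-1)%g (nu (s x))) sx (rmorphM nu) /= nx KautC -sx.
    exact: KautK.
  rewrite -[LHS]/((s^-1)%g (nu (s y))) sy (rmorphD nu) (rmorphM nu) /= ny !KautC -cE.
  by congr ((s^-1)%g _); rewrite sy (rmorphM iota); ring.
- apply/seteqP; split=> [s [[a [_ _ sx sy]] [b [_ _ sx' sy']]]|_ ->] /=.
    have b1 : b = 1.
      apply: (fmorph_inj iota); apply: (mulIf x_neq0).
      by rewrite -sx' sx rmorph1 mul1r.
    by apply: Kaut_ext; rewrite ?sx ?sy' ?b1 ?expr1n ?rmorph1 ?mul1r.
  by split; [case: groupG_closed|case: groupC_closed]; rewrite !(inE, unfold_in).
apply/seteqP; split=> // s _.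
have [b [e [bq b0 e0 sx sy]]] := Kaut_form s.
have [h Hh [hx hy]] := groupC_ex bq b0.
have e'0 : Tr q n.+1 ((b ^+ m)^-1 * e) = 0.
  have bVq : b^-1 ^+ (q ^ n.+1) = b^-1 by rewrite exprVn bq.
  by rewrite -exprVn Tr_scaleK ?invr_eq0 // e0 mulr0.
have [g Gg [gx gy]] := groupG_ex e'0.
exists g => //; exists h => //; apply: Kaut_ext.
  by rewrite -[LHS]/(g (h x)) hx (rmorphM g) /= gx KautC sx.
rewrite -[LHS]/(g (h y)) hy (rmorphM g) /= gy KautC sy mulrDr -rmorphM mulrA mulfV ?mul1r //.
by rewrite expf_neq0.
Qed.

Lemma card_Kaut : ([set: Kaut iota] #= `I_(d * (q ^ n.+1 - 1)))%card.
Proof.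
have [A [uA sA memA]] := trace_roots 0 pK pq q_gt1 (ltnW n_gt1).
have [B [uB sB memB]] : exists rs : seq K, [/\ uniq rs, size rs = (q ^ n.+1 - 1)%N
    & forall a, (a \in rs) = (a != 0) && (a ^+ (q ^ n.+1) == a)].
  apply: fixed_pow_roots.
    by rewrite expnS natrM (natr_pchar_eq0 pK pq) // mul0r.
  by rewrite -[X in (X < _)%N](expn0 q) ltn_exp2l.
have /choice[par parP] (s : Kaut iota) : exists ae : K * K,
    [/\ ae \in [seq (a, e) | a <- B, e <- A], s x = iota ae.1 * x
      & s y = iota (ae.1 ^+ m) * y + iota ae.2].
  have [a [e [aq a0 e0 sx sy]]] := Kaut_form s; exists (a, e); split=> //.
  by apply: allpairs_f; rewrite ?memA ?memB ?a0 ?aq ?e0 eqxx.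
have -> : (d * (q ^ n.+1 - 1) = size [seq (a, e) | a <- B, e <- A])%N.
  by rewrite size_allpairs sA sB mulnC.
apply: (card_eq_seq (f := par)).
- by apply: allpairs_uniq => // -[a e] [a' e'] _ _ [-> ->].
- by move=> s; have [] := parP s.
- move=> s s' E; have [_ sx sy] := parP s; have [_ sx' sy'] := parP s'.
  by apply: Kaut_ext; rewrite ?sx ?sx' ?sy ?sy' E.
move=> _ /allpairsP[[a e] [/= aB eA ->]].
move: aB eA; rewrite memA memB => /andP[a0 /eqP aq] /eqP e0.
have [s [sx sy]] := Kaut_ex aq a0 e0; exists s; have [_ sx' sy'] := parP s.
case: (par s) sx' sy' => a' e' /= sx' sy'.
by have [-> ->] := Kaut_params_inj (etrans (esym sx') sx) (etrans (esym sy') sy).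
Qed.

End NormTrace.

Local Open Scope classical_set_scope.
Local Open Scope card_scope.

Theorem theorem3p1
  (p : nat) (p_prime : prime p)
  (K : closedFieldType) (j : {rmorphism 'F_p -> K})
  (K_closure : is_algebraic_closure j)
  (q : nat) (q_pow : exists2 e : nat, (0 < e)%N & q = (p ^ e)%N)
  (r : nat) (r_ge3 : (3 <= r)%N)
  (F : fieldType) (iota : {rmorphism K -> F}) (x y : F)
  (F_function_field : is_function_field iota (norm_trace_poly K q r) x y) :
  [set: Kaut iota] #= `I_(q ^ (r - 1) * (q ^ r - 1))%N /\
  is_semidirect_product (groupG iota q r x y) (groupC iota q r x y).
Proof.
have pK : p \in [pchar K] by rewrite (fmorph_pchar j) pchar_Fp.
have [e e0 qE] := q_pow.
have pq : p.-nat q by rewrite qE pnatX pnat_id.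
have q_gt1 : (1 < q)%N by rewrite qE -[X in (X < _)%N](expn0 p) ltn_exp2l ?prime_gt1.
case: r r_ge3 F_function_field => // n n_gt1 [ker frac].
have swapP : swapXY (norm_trace_poly K q n.+1) = - trace_norm_poly K q n.
  have swapTr : swapXY (Tr q n.+1 'Y) = Tr q n.+1 'X :> {poly {poly K}}.
    rewrite /Tr (raddf_sum swapXY); apply: eq_bigr => i _ /=.
    by rewrite (rmorphXn swapXY) /= swapXY_Y.
  have swapX : swapXY ('X ^+ norm_exp q n.+1) = ('X ^+ norm_exp q n.+1)%:P :> {poly {poly K}}.
    by rewrite (rmorphXn swapXY) /= swapXY_X polyC_exp.
  by rewrite (raddfB swapXY) /= swapTr swapX opprB.
have ev_ker g : eval2 iota y x g = 0 <-> exists h, g = h * trace_norm_poly K q n.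
  rewrite -eval2_swap ker; split=> -[h hE].
    exists (- swapXY h); rewrite -[g]swapXYK hE rmorphM /= swapP.
    by rewrite mulrN mulNr.
  exists (- swapXY h); rewrite hE rmorphM -[norm_trace_poly _ _ _]swapXYK swapP.
  by rewrite (raddfN swapXY) mulrNN.
have ev_frac z : exists g h, eval2 iota y x h != 0 /\ z = eval2 iota y x g / eval2 iota y x h.
  have [g [h [h0 ->]]] := frac z; exists (swapXY g), (swapXY h).
  by rewrite !eval2_swap.
split; last exact: (groupG_groupC_semidirect pK pq q_gt1 n_gt1 ev_ker ev_frac).
by rewrite subn1; apply: (card_Kaut pK pq q_gt1 n_gt1 ev_ker ev_frac).
Qed.
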